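(* Let $q=p^k$ be a prime power, with $p$ prime and $k\geq 1$. Let $P_2=P_2(N)$ be the probability for a uniformly random matrix $H\in M_{2\times N}(\mathbb Z_q)$ to be partial Butson. Then, as $N\to\infty$ with $N\in p\mathbb N$, $$P_2\simeq\sqrt{\frac{p^{2-\frac{q}{p}}\,q^{\,q-\frac{q}{p}}}{(2\pi N)^{q-\frac{q}{p}}}}.$$ In particular, for $q=p$ prime, $P_2\simeq\sqrt{\frac{p^p}{(2\pi N)^{p-1}}}$.
   Context: $\mathbb Z_q\subset\mathbb C^\times$ denotes the multiplicative group of complex $q$-th roots of unity, and $M_{M\times N}(\mathbb Z_q)$ the set of $M\times N$ matrices with all entries in $\mathbb Z_q$. A matrix $H\in M_{M\times N}(\mathbb Z_q)$ is called partial Butson if its rows are pairwise orthogonal for the usual Hermitian scalar product of $\mathbb C^N$. A random matrix is uniformly distributed, so the probability is $P_M=q^{-MN}\cdot\#\{H\in M_{M\times N}(\mathbb Z_q): H\text{ partial Butson}\}$. The symbol $\simeq$ means that the ratio of the two sides tends to $1$. *)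

(* Defs.v *)
From mathcomp Require Import all_boot all_order all_algebra.
From mathcomp Require Import all_classical all_reals all_analysis.
From mathcomp Require Import finmap.
From mathcomp Require Export complex.

Set Implicit Arguments.
Unset Strict Implicit.
Unset Printing Implicit Defensive.

Import Order.TTheory GRing.Theory Num.Theory.
Local Open Scope classical_set_scope.
Local Open Scope ring_scope.

Section PartialButson.
Variable R : realType.

Definition pairwise_orthogonal_rows (M N : nat) (H : 'M[R[i]]_(M, N)) : Prop :=
  forall i j : 'I_M, i != j -> dotmx (row i H) (row j H) = 0.

Definition partial_butson (q M N : nat) : set 'M[R[i]]_(M, N) :=
  [set H | H \is a mxOver q.-unity_root /\ pairwise_orthogonal_rows H].

Arguments partial_butson : clear implicits.

Lemma finite_partial_butson (q M N : nat) :
  (0 < q)%N -> finite_set (partial_butson q M N).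
Proof.
move=> q_gt0.
have [s Es] := closed_field_poly_normal ('X^q - 1 : {poly R[i]}).
have rootS z : q.-unity_root z -> z \in s.
  rewrite /root_of_unity Es rootZ ?root_prod_XsubC//.
  by rewrite lead_coef_eq0 -size_poly_eq0 size_XnsubC.
apply: (@sub_finite_set _ _
  ((fun A : 'M[seq_sub s]_(M, N) => map_mx val A) @` setT)); last first.
  exact/finite_image/finite_finset.
move=> H [/mxOverP HH _].
exists (\matrix_(i, j) SeqSub (rootS _ (HH i j))) => //.
by apply/matrixP => i j; rewrite !mxE.
Qed.

(* fset_set returns fset0 on infinite sets; by finite_partial_butson this does
   not occur when 0 < q. *)
Definition butson_proba (q M N : nat) : R :=
  (#|` fset_set (partial_butson q M N)|)%:R / q%:R ^+ (M * N).

End PartialButson.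

(* Main.v *)
(** Write [q = p * s].  A sum of [q]-th roots of unity vanishes iff the multiplicity
    of the [i]-th root depends only on [i] modulo [s].  Grouping the exponents by their
    class modulo [s], the probability [P_2] for [N = p * n] becomes the expectation,
    over a uniform word of length [N] on [s] letters, of the product over the letters
    of [v (X_j / p)], restricted to the words all of whose letter counts [X_j] are
    divisible by [p]; here [v a = (p a)! / (a!^p p^(p a))].  By Stirling's formula
    [v a] is equivalent to [sqrt (p / (2 pi a)^(p - 1))], by Chernoff's bound every
    [X_j / p] is concentrated at [n / s], and by a character sum the divisibility
    condition has a probability tending to [p^(1 - s)]. *)
Require Import Defs.
From mathcomp Require Import all_boot all_order all_algebra.
From mathcomp Require Import all_classical all_reals all_analysis.
From mathcomp Require Import finmap.
From mathcomp Require Import cyclic separable algC cyclotomic.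
From mathcomp Require Import ring lra.

Import Order.TTheory GRing.Theory Num.Theory numFieldNormedType.Exports.
Local Open Scope classical_set_scope.
Local Open Scope ring_scope.

(** * Stirling's formula *)

(** Grouping by class modulo [s] avoids a local limit theorem on [p * s] letters. The multinomial
    coefficient of the full word factors into that of its word of classes, with counts [p * a j],
    and one factor [v (a j)] per class, so the decay of [P_2] is carried by the factors [v] alone.
    Divisibility and concentration are decoupled as follows. After multiplication by
    [sqrt n ^ ((p - 1) s)], the product of the [v] is close to a constant on every word with counts
    near the mean, so the expectation is compared with that constant times the probability of
    divisibility. On the other words [v] is merely bounded by 1; their exponentially small
    probability beats the polynomial normalisation. The limit [p^(1 - s)] counts characters: among
    [p^s] tuples of exponents, the [p] constant ones contribute 1 each because [p] divides [N], and
    the others decay geometrically. The vanishing criterion is a matter of degree: a primitive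
    [q]-th root of unity has degree [s (p - 1)] over the rationals, which leaves only the relations
    carried by cosets of the [p]-th roots of unity. *)

(** This replaces the comparison of integrals, both for Wallis' integrals and for the bounds on
    [ln]. *)
Lemma is_derive_ge0_le (R : realType) (f g : R -> R) (a b : R) : a <= b ->
  (forall x, a <= x <= b -> is_derive x 1 f (g x)) ->
  (forall x, a <= x <= b -> 0 <= g x) -> f a <= f b.
Proof.
move=> ab df g0.
have sub x : x \in `]a, b[ -> a <= x <= b by rewrite in_itv => /andP[/ltW-> /ltW->].
have dfx x (xab : a <= x <= b) : derivable f x 1.
  by have := df x xab => ?; exact: ex_derive.
apply: (@ger0_derive1_ndecr R f a b) => //.
- by move=> x /sub /dfx.
- by move=> x /sub xab; have dx := df x xab; rewrite derive1E derive_val g0.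
- by apply: derivable_within_continuous => x; rewrite in_itv => /dfx.
Qed.

(* The antiderivative of [cos x ^+ n] vanishing at [0], by the reduction formula;
   its value at [pi / 2] is Wallis' integral. *)
Fixpoint cosX_antider (R : realType) (n : nat) (x : R) : R :=
  match n with
  | 0 => x
  | m'.+1 => if m' is m.+1 then
       (m.+1%:R * cosX_antider R m x + sin x * cos x ^+ m.+1) / m.+2%:R
     else sin x
  end.

Lemma is_derive_cosX_antider (R : realType) (n : nat) (x : R) :
  is_derive x 1 (cosX_antider R n) (cos x ^+ n).
Proof.
elim/ltn_ind: n => -[|[|n]] IH /=.
- by rewrite expr0; exact: is_derive_id.
- by rewrite expr1; exact: is_derive_sin.
- have /= IHn := IH n (ltnW (ltnSn _)).
  pose f := n.+2%:R^-1 *: (n.+1%:R *: cosX_antider R n + (@sin R) * (@cos R) ^+ n.+1).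
  have -> : (fun y : R =>
      (n.+1%:R * cosX_antider R n y + sin y * cos y ^+ n.+1) / n.+2%:R) = f.
    apply/funext => y; by rewrite /f !fctE mulrC.
  rewrite {}/f; apply: is_derive_eq; rewrite /GRing.scale /=.
  have n2 : (n.+2%:R : R) != 0 by rewrite pnatr_eq0.
  apply: (mulfI n2); rewrite mulVKf// fctE.
  have -> : sin x * (n.+1%:R * cos x ^+ n * - sin x) =
      - (n.+1%:R * cos x ^+ n) * sin x ^+ 2 by ring.
  by rewrite sin2cos2 !exprS; ring.
Qed.

Definition wallis (R : realType) (n : nat) : R := cosX_antider R n (pi / 2).

Lemma wallisS (R : realType) (n : nat) :
  wallis R n.+2 = n.+1%:R / n.+2%:R * wallis R n.
Proof. by rewrite /wallis /= cos_pihalf expr0n/= mulr0 addr0 mulrAC. Qed.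

Lemma cosX_antider0 (R : realType) (n : nat) : cosX_antider R n 0 = 0.
Proof.
elim/ltn_ind: n => -[|[|n]] IH //=; first by rewrite sin0.
by rewrite IH ?ltnS// sin0 mul0r mulr0 addr0 mul0r.
Qed.

Lemma wallis_ge0 (R : realType) (n : nat) : 0 <= wallis R n.
Proof.
rewrite -[leLHS](cosX_antider0 R n).
apply: (@is_derive_ge0_le R _ (fun x => cos x ^+ n)).
- by rewrite divr_ge0 ?pi_ge0.
- by move=> x _; exact: is_derive_cosX_antider.
move=> x /andP[x0 xpi]; apply/exprn_ge0/cos_ge0_pihalf.
by rewrite xpi (le_trans _ x0)// oppr_le0 divr_ge0 ?pi_ge0.
Qed.

Lemma wallis_nincr (R : realType) (n : nat) : wallis R n.+1 <= wallis R n.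
Proof.
rewrite -subr_ge0.
have <- : (cosX_antider R n - cosX_antider R n.+1) 0 = 0.
  by rewrite !fctE !cosX_antider0 subr0.
have -> : wallis R n - wallis R n.+1 =
  (cosX_antider R n - cosX_antider R n.+1) (pi / 2) by [].
apply: (@is_derive_ge0_le R _ (fun x => cos x ^+ n - cos x ^+ n.+1)).
- by rewrite divr_ge0 ?pi_ge0.
- move=> x _; have ? := is_derive_cosX_antider R n x.
  by have ? := is_derive_cosX_antider R n.+1 x; exact: is_deriveB.
move=> x /andP[x0 xpi].
have c0 : 0 <= cos x.
  apply/cos_ge0_pihalf; rewrite xpi (le_trans _ x0)// oppr_le0.
  by rewrite divr_ge0 ?pi_ge0.
by rewrite subr_ge0 exprS ler_piMl ?exprn_ge0 ?cos_le1.
Qed.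

(** The two-step recurrence makes this product independent of [n]. Combined with monotonicity it
    pins down the square of [wallis R n], and it is the source of [pi] in Stirling's formula. *)
Lemma wallisM (R : realType) (n : nat) :
  n.+1%:R * wallis R n * wallis R n.+1 = pi / 2.
Proof.
elim: n => [|n IH]; first by rewrite /wallis /= sin_pihalf mulr1 mul1r.
have : (n.+2%:R : R) != 0 by rewrite pnatr_eq0.
by rewrite wallisS -IH; move: (n.+1%:R) (n.+2%:R) => a b b0; field.
Qed.

(* The probability that a uniform word of length [p * a] over [p] letters
   contains each letter exactly [a] times. *)
Definition balanced_proba (R : realType) (p a : nat) : R :=
  (p * a)`!%:R / (a`!%:R ^+ p * p%:R ^+ (p * a)).

(** Here [balanced_proba R 2 n] is the central binomial probability; this link turns Wallis' product
    into the value of Stirling's constant. *)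
Lemma wallis_even (R : realType) (n : nat) :
  wallis R (2 * n) = pi / 2 * balanced_proba R 2 n.
Proof.
elim: n => [|n IH].
  by rewrite /wallis /= /balanced_proba muln0 fact0 expr0 expr1n !mul1r invr1 mulr1.
have -> : (2 * n.+1)%N = (2 * n).+2 by rewrite mulnS.
rewrite wallisS IH /balanced_proba.
have -> : (2 * n.+1)%N = (2 * n).+2 by rewrite mulnS.
rewrite !factS !natrM !exprS.
have f0 : (n`!%:R : R) != 0 by rewrite pnatr_eq0 -lt0n fact_gt0.
have -> : (2 * n).+2%:R = 2 * n.+1%:R :> R by rewrite -natrM mulnS.
have n1 : (n.+1%:R : R) != 0 by rewrite pnatr_eq0.
have p2 : (2 ^+ (2 * n) : R) != 0 by rewrite expf_neq0.
move: (n.+1%:R : R) n1 => b b0.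
by field; rewrite f0 p2 b0.
Qed.

(** The bound is the Padé approximant of [ln] at 1. At [y = (n + 1) / n], multiplied by [n + 1/2],
    it equals exactly 1, which is what monotonicity of the Stirling ratio requires. *)
Lemma ln_ge_pade (R : realType) (y : R) : 1 <= y ->
  2 * (y - 1) / (y + 1) <= ln y.
Proof.
move=> y1; pose f (x : R) := ln x + 4 * (x + 1)^-1.
have df x : 1 <= x <= y -> is_derive x 1 f (x^-1 - 4 / (x + 1) ^+ 2).
  move=> /andP[x1 _].
  have dln := is_derive1_ln (lt_le_trans ltr01 x1).
  have dV : is_derive x 1 (fun x : R => ((id + cst 1) x)^-1)
      (- (id x + cst 1 x) ^- 2 *: (1 + 0)).
    by apply: is_deriveV; apply/lt0r_neq0; change (0 < x + 1); lra.
  have -> : f = @ln R + (4 : R) *: (fun x : R => ((id + cst 1) x)^-1).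
    by apply/funext => z; rewrite !fctE.
  apply: is_derive_eq (is_deriveD dln (is_deriveZ 4 dV)) _.
  rewrite /GRing.scale/=.
  by field; rewrite ?lt0r_neq0//; lra.
have := @is_derive_ge0_le R f _ 1 y y1 df.
rewrite /f ln1 add0r => h.
have {h} : 4 / (1 + 1) <= ln y + 4 / (y + 1).
  apply: h => x /andP[x1 _].
  have -> : x^-1 - 4 / (x + 1) ^+ 2 = (x - 1) ^+ 2 / (x * (x + 1) ^+ 2).
    by field; rewrite ?lt0r_neq0//; lra.
  by rewrite divr_ge0 ?sqr_ge0// mulr_ge0 ?sqr_ge0//; lra.
have -> : 2 * (y - 1) / (y + 1) = 2 - 4 / (y + 1).
  by field; rewrite ?lt0r_neq0//; lra.
have : (4 / (1 + 1) : R) = 2 by field.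
lra.
Qed.

(** The right-hand side is the trapezoidal rule for the integral of the convex function [1 / x] over
    [[1, y]]. At [y = (n + 1) / n] it yields a telescoping error term. *)
Lemma ln_le_trapezoid (R : realType) (y : R) : 1 <= y ->
  ln y <= (y - y^-1) / 2.
Proof.
move=> y1; pose f := (2^-1 : R) *: (id - (fun x : R => (id x)^-1)) - @ln R.
have: f 1 <= f y.
  apply: (@is_derive_ge0_le R f (fun x => 2^-1 * (1 + x ^- 2) - x^-1) 1 y y1).
    move=> x /andP[x1 _].
    have dln := is_derive1_ln (lt_le_trans ltr01 x1).
    have dV : is_derive x 1 (fun x : R => (id x)^-1) (- (id x) ^- 2 *: 1).
      by apply: is_deriveV; apply/lt0r_neq0/(lt_le_trans ltr01).
    apply: is_derive_eq; rewrite /GRing.scale/=.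
    by field; rewrite ?lt0r_neq0//; lra.
  move=> x /andP[x1 _].
  have -> : 2^-1 * (1 + x ^- 2) - x^-1 = (1 - x^-1) ^+ 2 / 2.
    by field; rewrite ?lt0r_neq0//; lra.
  by rewrite divr_ge0 ?sqr_ge0.
rewrite /f !fctE/= ln1 invr1 subrr /GRing.scale/=; lra.
Qed.

Definition stirling_ratio (R : realType) (n : nat) : R :=
  n`!%:R / (Num.sqrt n%:R * (n%:R / expR 1) ^+ n).

Lemma stirling_ratio_gt0 (R : realType) (n : nat) :
  (0 < n)%N -> 0 < stirling_ratio R n.
Proof.
move=> n0; rewrite divr_gt0 ?ltr0n ?fact_gt0// mulr_gt0//.
  by rewrite sqrtr_gt0 ltr0n.
by rewrite exprn_gt0// divr_gt0 ?expR_gt0 ?ltr0n.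
Qed.

Lemma ln_stirling_ratio (R : realType) (n : nat) : (0 < n)%N ->
  ln (stirling_ratio R n) = ln (n`!%:R) - (n%:R + 2^-1) * ln n%:R + n%:R.
Proof.
move=> n0; have n0' : (0 : R) < n%:R by rewrite ltr0n.
have s0 : (0 : R) < Num.sqrt n%:R by rewrite sqrtr_gt0.
have e0 : (0 : R) < n%:R / expR 1 by rewrite divr_gt0 ?expR_gt0.
have f0 : (0 : R) < n`!%:R by rewrite ltr0n fact_gt0.
rewrite /stirling_ratio ln_div ?posrE ?mulr_gt0 ?exprn_gt0//.
rewrite lnM ?posrE ?exprn_gt0// lnXn// ln_div ?posrE ?expR_gt0// expRK.
have -> : ln (n%:R : R) = 2 * ln (Num.sqrt n%:R).
  by rewrite mulr_natl -lnXn// sqr_sqrtr ?ler0n.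
by rewrite -[(_ - _) *+ n]mulr_natl; field.
Qed.

Lemma ln_stirling_ratioB (R : realType) (n : nat) : (0 < n)%N ->
  ln (stirling_ratio R n) - ln (stirling_ratio R n.+1) =
  (n%:R + 2^-1) * ln (n.+1%:R / n%:R) - 1.
Proof.
move=> n0; rewrite !ln_stirling_ratio// factS natrM.
rewrite lnM ?posrE ?ltr0n ?fact_gt0// ln_div ?posrE ?ltr0n//.
by rewrite -[n.+1%:R]natr1; field.
Qed.

Lemma ln_stirling_ratio_step (R : realType) (n : nat) : (0 < n)%N ->
  0 <= ln (stirling_ratio R n) - ln (stirling_ratio R n.+1)
    <= (4 * n%:R)^-1 - (4 * n.+1%:R)^-1.
Proof.
move=> n0; rewrite ln_stirling_ratioB//.
have n0' : (0 : R) < n%:R by rewrite ltr0n.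
have y1 : 1 <= (n.+1%:R / n%:R : R) by rewrite ler_pdivlMr// mul1r ler_nat.
have := ln_ge_pade _ _ y1; have := ln_le_trapezoid _ _ y1.
rewrite -[n.+1%:R]natr1; move: (n%:R : R) n0' {y1} => x x0.
set l := ln _ => h1 h2.
have x2 : 0 < x + 2^-1 by lra.
apply/andP; split.
  rewrite subr_ge0; apply: le_trans (ler_wpM2l (ltW x2) h2).
  rewrite le_eqVlt; apply/orP; left; apply/eqP; field; rewrite ?lt0r_neq0//; lra.
rewrite lerBlDr; apply: le_trans (ler_wpM2l (ltW x2) h1) _.
rewrite le_eqVlt; apply/orP; left; apply/eqP; field; rewrite ?lt0r_neq0//; lra.
Qed.

(** The logarithm decreases by steps bounded by telescoping differences, hence converges. The value
    of the limit is left open here; its positivity allows it to be solved for in [stirling]. *)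
Lemma stirling_ratio_is_cvg (R : realType) :
  exists2 L : R, 0 < L & stirling_ratio R n @[n --> \oo] --> L.
Proof.
(* The shift avoids index 0, where the denominator of the ratio vanishes. *)
pose u n := ln (stirling_ratio R n.+1).
have u_step n : 0 <= u n - u n.+1 <= (4 * n.+1%:R)^-1 - (4 * n.+2%:R)^-1.
  exact: ln_stirling_ratio_step.
have u_lb n : u 0 - 4^-1 + (4 * n.+1%:R)^-1 <= u n.
  elim: n => [|n IH]; first by rewrite mulr1 subrK.
  have /andP[_] := u_step n.
  by move: (4 * _)^-1 (4 * _)^-1 IH => x y; lra.
have [l ul] : exists l : R, u n @[n --> \oo] --> l.
  suff : cvgn u by move=> /cvg_ex.
  apply: nonincreasing_is_cvgn.
    by apply/nonincreasing_seqP => n; have /andP[+ _] := u_step n; lra.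
  exists (u 0 - 4^-1) => _ [n _ <-]; apply: le_trans (u_lb n).
  by rewrite lerDl invr_ge0 mulr_ge0.
exists (expR l); first exact: expR_gt0.
rewrite -(cvg_shiftS (stirling_ratio R)).
have -> : (fun n => stirling_ratio R n.+1) = expR \o u.
  by apply/funext => n; rewrite /u /= lnK// posrE stirling_ratio_gt0.
by apply: continuous_cvg => //; exact: continuous_expR.
Qed.

(** All powers of [a], [p] and [expR 1] cancel, so this is an exact identity: a limit [L] of the
    Stirling ratio gives [sqrt p * L ^ (1 - p)] on the right. *)
Lemma balanced_proba_stirling (R : realType) (p a : nat) :
  (0 < p)%N -> (0 < a)%N ->
  Num.sqrt a%:R ^+ p.-1 * balanced_proba R p a =
  Num.sqrt p%:R * (stirling_ratio R (p * a) / stirling_ratio R a ^+ p).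
Proof.
move=> p0 a0; rewrite /stirling_ratio /balanced_proba natrM sqrtrM ?ler0n//.
have sa0 : Num.sqrt (a%:R : R) != 0 by rewrite sqrtr_eq0 -ltNge ltr0n.
have sp0 : Num.sqrt (p%:R : R) != 0 by rewrite sqrtr_eq0 -ltNge ltr0n.
have fa0 : (a`!%:R : R) != 0 by rewrite pnatr_eq0 -lt0n fact_gt0.
have e0 : expR (1 : R) != 0 by rewrite gt_eqF ?expR_gt0.
have a0' : (a%:R : R) != 0 by rewrite pnatr_eq0 -lt0n.
have p0' : (p%:R : R) != 0 by rewrite pnatr_eq0 -lt0n.
pose X := (a%:R / expR 1 : R) ^+ (p * a).
have -> : (p%:R * a%:R / expR 1 : R) ^+ (p * a) = p%:R ^+ (p * a) * X.
  by rewrite -mulrA exprMn.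
have -> : (a`!%:R / (Num.sqrt a%:R * (a%:R / expR 1) ^+ a) : R) ^+ p =
    a`!%:R ^+ p / (Num.sqrt a%:R ^+ p * X).
  by rewrite expr_div_n exprMn -exprM mulnC.
have X0 : X != 0 by rewrite expf_neq0// mulf_neq0// invr_eq0.
have Y0 : (p%:R : R) ^+ (p * a) != 0 by rewrite expf_neq0.
have F0 : (a`!%:R : R) ^+ p != 0 by rewrite expf_neq0.
have -> : Num.sqrt (a%:R : R) ^+ p = Num.sqrt a%:R ^+ p.-1 * Num.sqrt a%:R.
  by rewrite -exprSr prednK.
have Z0 : Num.sqrt (a%:R : R) ^+ p.-1 != 0 by rewrite expf_neq0.
move: (_ ^+ p.-1) (_ ^+ (p * a)) (_ ^+ p) Z0 Y0 F0 => z y f z0 y0 f0.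
by field; rewrite f0 y0 X0 z0 sa0 sp0.
Qed.

Lemma balanced_proba2_cvg (R : realType) :
  Num.sqrt n%:R * balanced_proba R 2 n @[n --> \oo] --> (Num.sqrt (pi : R))^-1.
Proof.
have pi0 := @pi_gt0 R.
(* With [m = n + 1], the upper bound comes from [W_(2m) <= W_(2m-1)] and the lower one from
   [W_(2m+1) <= W_(2m)], each inserted in the corresponding instance of [wallisM]. *)
have sqr_bound n :
   1 - 2^-1 * n.+1%:R^-1 <= pi * (n.+1%:R * balanced_proba R 2 n.+1 ^+ 2) <= 1.
  have := wallisM R (2 * n.+1); have := wallisM R (2 * n).+1.
  have := wallis_nincr R (2 * n.+1).
  have := wallis_nincr R (2 * n).+1.
  have -> : (2 * n).+2 = (2 * n.+1)%N by rewrite mulnS.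
  have := wallis_ge0 R (2 * n.+1).
  rewrite -[(2 * n.+1).+1%:R]natr1 natrM wallis_even.
  move: (n.+1%:R : R) (ltr0Sn R n) (wallis R _) (wallis R _) (balanced_proba R _ _).
  move=> x x0 v w b W0 Wv wW e1 e2.
  set y := pi * (x * b ^+ 2).
  have y1 : y <= 1.
    rewrite -(ler_pM2l (_ : 0 < pi / 2)) ?divr_gt0// mulr1 -[leRHS]e1.
    have -> : pi / 2 * y = 2 * x * (pi / 2 * b) * (pi / 2 * b).
      by rewrite /y; field.
    by rewrite ler_wpM2r// ler_wpM2l// mulr_ge0// ltW.
  rewrite y1 andbT.
  have : 1 <= y + y * (2^-1 * x^-1).
    rewrite -(ler_pM2l (_ : 0 < pi / 2)) ?divr_gt0// mulr1 -[leLHS]e2.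
    have -> : pi / 2 * (y + y * (2^-1 / x)) = (2 * x + 1) * (pi / 2 * b) * (pi / 2 * b).
      by rewrite /y; field; rewrite gt_eqF.
    by rewrite ler_wpM2l// mulr_ge0// addr_ge0// mulr_ge0// ltW.
  have : y * (2^-1 * x^-1) <= 2^-1 * x^-1.
    by rewrite ler_piMl// mulr_ge0 ?invr_ge0// ltW.
  lra.
have sqr_cvg :
    pi * (n.+1%:R * balanced_proba R 2 n.+1 ^+ 2) @[n --> \oo] --> (1 : R).
  apply: (@squeeze_cvgr _ _ _ _ (fun n => 1 - 2^-1 * n.+1%:R^-1) (cst 1)).
  - by near=> n; exact: sqr_bound.
  - rewrite -[X in _ --> X]subr0 -[X in 1 - X](mulr0 2^-1).
    apply: cvgB; first exact: cvg_cst.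
    by apply: cvgMr; exact: cvg_harmonic.
  - exact: cvg_cst.
rewrite -cvg_shiftS /=.
have -> : (fun n => Num.sqrt n.+1%:R * balanced_proba R 2 n.+1) =
   (fun n => (Num.sqrt pi)^-1 *
      Num.sqrt (pi * (n.+1%:R * balanced_proba R 2 n.+1 ^+ 2))).
  apply/funext => n; rewrite sqrtrM ?pi_ge0// mulKf ?sqrtr_eq0 -?ltNge//.
  rewrite sqrtrM ?ler0n// sqrtr_sqr ger0_norm//.
  by rewrite divr_ge0// mulr_ge0// exprn_ge0.
suff : (Num.sqrt pi)^-1 * Num.sqrt (pi * (n.+1%:R * balanced_proba R 2 n.+1 ^+ 2))
    @[n --> \oo] --> (Num.sqrt (pi : R))^-1 * Num.sqrt 1.
  by rewrite sqrtr1 mulr1.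
apply: cvgMr.
by apply: continuous_cvg => //; exact: sqrt_continuous.
Unshelve. all: by end_near. Qed.

Lemma stirling (R : realType) :
  stirling_ratio R n @[n --> \oo] --> Num.sqrt (2 * pi).
Proof.
have [L L0 SL] := stirling_ratio_is_cvg R.
suff <- : L = Num.sqrt (2 * pi) by [].
have mul2oo : (2 * n)%N @[n --> \oo] --> \oo.
  apply/cvgnyPge => A; near=> n; rewrite (@leq_trans n) ?leq_pmull//.
  by near: n; exact: nbhs_infty_ge.
have S2L : stirling_ratio R (2 * n) @[n --> \oo] --> L.
  exact: (cvg_comp _ _ mul2oo SL).
(* The case [p = 2], whose limit is known from Wallis, gives an equation for [L]. *)
have e : (Num.sqrt (pi : R))^-1 = Num.sqrt 2 * (L / L ^+ 2).
  apply/esym/(cvg_unique _ _ (balanced_proba2_cvg R)) => //.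
  apply: (@cvg_trans _ ((fun n => Num.sqrt 2 *
     (stirling_ratio R (2 * n) / stirling_ratio R n ^+ 2)) @ \oo)).
    apply: near_eq_cvg; near=> n.
    have n0 : (0 < n)%N by near: n; exact: nbhs_infty_gt.
    by rewrite -balanced_proba_stirling.
  apply: cvgMr; apply: cvgM => //; apply: cvgV; first by rewrite expf_neq0// gt_eqF.
  by rewrite !expr2; apply: cvgM.
have sp0 : Num.sqrt (pi : R) != 0 by rewrite sqrtr_eq0 -ltNge pi_gt0.
rewrite sqrtrM//; apply: (mulIf (invr_neq0 sp0)).
by rewrite mulfK// e; field; rewrite gt_eqF.
Unshelve. all: by end_near. Qed.

Lemma balanced_proba_cvg (R : realType) (p : nat) : (0 < p)%N ->
  Num.sqrt n%:R ^+ p.-1 * balanced_proba R p n @[n --> \oo] -->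
    Num.sqrt p%:R / Num.sqrt (2 * pi) ^+ p.-1.
Proof.
move=> p0.
have s0 : Num.sqrt (2 * pi : R) != 0.
  by rewrite sqrtr_eq0 -ltNge mulr_gt0// pi_gt0.
have -> : Num.sqrt p%:R / Num.sqrt (2 * pi) ^+ p.-1 =
    Num.sqrt (p%:R : R) * (Num.sqrt (2 * pi) / Num.sqrt (2 * pi) ^+ p).
  congr (_ * _); rewrite -[in RHS](prednK p0) exprS invfM mulVKf//.
have muloo : (p * n)%N @[n --> \oo] --> \oo.
  apply/cvgnyPge => A; near=> n; rewrite (@leq_trans n) ?leq_pmull//.
  by near: n; exact: nbhs_infty_ge.
apply: (@cvg_trans _ ((fun n => Num.sqrt p%:R *
     (stirling_ratio R (p * n) / stirling_ratio R n ^+ p)) @ \oo)).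
  apply: near_eq_cvg; near=> n.
  have n0 : (0 < n)%N by near: n; exact: nbhs_infty_gt.
  by rewrite -balanced_proba_stirling.
apply: cvgMr; apply: cvgM; first exact: (cvg_comp _ _ muloo (stirling R)).
apply: cvgV; first by rewrite expf_neq0.
apply: (cvg_comp (stirling_ratio R) (fun x => x ^+ p) (stirling R)).
exact: exprn_continuous.
Unshelve. all: by end_near. Qed.

(** * Words with prescribed letter counts *)

Definition letter_count (T : finType) (N : nat) (w : {ffun 'I_N -> T}) (t : T) : nat :=
  \sum_(k < N) (w k == t).

Lemma sum_letter_count (T : finType) (N : nat) (w : {ffun 'I_N -> T}) :
  (\sum_t letter_count T N w t = N)%N.
Proof.
rewrite /letter_count exchange_big -[RHS](card_ord N) -sum1_card /=.
apply: eq_bigr => k _.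
by rewrite (bigD1 (w k))//= eqxx big1 ?addn0// => t; rewrite eq_sym => /negbTE->.
Qed.

Definition word_cons (T : finType) (N : nat) (t : T) (w : {ffun 'I_N -> T}) :
  {ffun 'I_N.+1 -> T} := [ffun i => if unlift ord0 i is Some j then w j else t].

Lemma letter_count_cons (T : finType) (N : nat) (t : T) (w : {ffun 'I_N -> T}) (u : T) :
  letter_count T N.+1 (word_cons T N t w) u = ((t == u) + letter_count T N w u)%N.
Proof.
rewrite /letter_count big_ord_recl ffunE unlift_none; congr (_ + _)%N.
by apply: eq_bigr => k _; rewrite ffunE liftK.
Qed.

Lemma sum_word_cons (T : finType) (N : nat) (F : {ffun 'I_N.+1 -> T} -> nat) :
  (\sum_w F w = \sum_t \sum_w F (word_cons T N t w))%N.
Proof.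
rewrite pair_big /= (reindex (fun x => word_cons T N x.1 x.2)) //=.
exists (fun w => (w ord0, [ffun j => w (lift ord0 j)])) => [[t w] _|w _] /=.
  rewrite ffunE unlift_none; congr (_, _).
  by apply/ffunP => j; rewrite !ffunE liftK.
apply/ffunP => i; rewrite ffunE; case: unliftP => [j ->|->//].
by rewrite ffunE.
Qed.

(** The multinomial formula without division, by induction on the length after removal of the first
    letter. *)
Lemma count_words (T : finType) (N : nat) (c : T -> nat) : (\sum_t c t = N)%N ->
  ((\sum_(w : {ffun 'I_N -> T}) [forall t, letter_count T N w t == c t]) *
    \prod_t (c t)`! = N`!)%N.
Proof.
elim: N c => [|N IH] c sc.
  have c0 t : c t = 0%N.
    by apply/eqP; rewrite -leqn0 -sc (bigD1 t)//= leq_addr.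
  rewrite [X in (_ * X)%N]big1 ?muln1 => [|t _]; last by rewrite c0.
  rewrite (eq_bigr (fun=> 1%N)) => [|w _].
    by rewrite sum1_card card_ffun card_ord expn0.
  suff -> : [forall t, letter_count T 0 w t == c t] by [].
  by apply/forallP => t; rewrite /letter_count big_ord0 c0.
(* Writing the factor [N + 1] of the factorial as the sum of the [c t] splits the identity according
   to the first letter [t]. *)
rewrite sum_word_cons big_distrl /= factS -[in RHS]sc [RHS]big_distrl /=.
apply: eq_bigr => t _.
have [ct0|ct0] := posnP (c t).
  rewrite ct0 mul0n big1 ?mul0n// => w _.
  case: forallP => // /(_ t).
  by rewrite letter_count_cons eqxx ct0.
pose c' u := (c u - (t == u))%N.
have cE u : c u = ((t == u) + c' u)%N.
  by rewrite /c' subnKC//; case: eqP => // <-.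
have sc' : (\sum_u c' u = N)%N.
  apply/eqP; rewrite -(eqn_add2l 1) [X in _ == X]add1n -sc.
  rewrite [X in _ == X](eq_bigr _ (fun u _ => cE u)) big_split /=.
  suff -> : (\sum_u (t == u) = 1)%N by rewrite add1n.
  by rewrite (bigD1 t)//= eqxx big1 ?addn0// => u; rewrite eq_sym => /negbTE->.
rewrite -(IH c' sc') mulnCA; congr (_ * _)%N.
  apply: eq_bigr => w _; congr (nat_of_bool _); apply: eq_forallb => u.
  by rewrite letter_count_cons cE eqn_add2l.
rewrite (bigD1 t)//= [in RHS](bigD1 t)//= mulnA; congr (_ * _)%N.
  by rewrite /c' eqxx subn1 -[in LHS](prednK ct0) factS prednK.
by apply: eq_bigr => u; rewrite /c' eq_sym => /negbTE->; rewrite subn0.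
Qed.

Lemma count_words_eq0 (T : finType) (N : nat) (c : T -> nat) : (\sum_t c t)%N != N ->
  (\sum_(w : {ffun 'I_N -> T}) [forall t, letter_count T N w t == c t] = 0)%N.
Proof.
move=> sc; apply: big1 => w _; case: forallP => // h.
move: sc; rewrite -(eq_bigr _ (fun t _ => eqP (h t))).
by rewrite sum_letter_count eqxx.
Qed.

(** The letter [(u, j)] will stand for the exponent [s * u + j], so [j] is its class modulo [s]. *)
Definition balanced (p s N : nat) (r : {ffun 'I_N -> 'I_p * 'I_s}) : bool :=
  [forall j, forall u, forall v,
    letter_count _ N r (u, j) == letter_count _ N r (v, j)].

Lemma letter_count_ltn (T : finType) (N : nat) (w : {ffun 'I_N -> T}) (t : T) :
  (letter_count T N w t < N.+1)%N.
Proof. by rewrite ltnS -[leqRHS](sum_letter_count T N w) (bigD1 t)//= leq_addr. Qed.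

(** At most one [a] fits a given word, so the sum of indicators is the indicator of existence. With
    [sum_divisible_words] it puts both sides of [balanced_words] over the same index set of tuples
    [a]. *)
Lemma balanced_sum (p s N : nat) (r : {ffun 'I_N -> 'I_p * 'I_s}) : (0 < p)%N ->
  (balanced p s N r = \sum_(a : {ffun 'I_s -> 'I_N.+1})
     [forall t, letter_count _ N r t == a t.2] :> nat)%N.
Proof.
move=> p0; pose u0 := Ordinal p0.
have [/forallP bal|nbal] := boolP (balanced p s N r).
  pose a := [ffun j => Ordinal (letter_count_ltn _ N r (u0, j))].
  rewrite (bigD1 a)//= big1 ?addn0 => [|b ba].
    suff -> : [forall t, letter_count _ N r t == a t.2] by [].
    apply/forallP => -[u j]; rewrite ffunE /=.
    by have /forallP/(_ u)/forallP := bal j.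
  case: forallP => // h.
  case/eqP: ba; apply/ffunP => j; apply: val_inj; rewrite ffunE/=.
  by rewrite (eqP (h (u0, j))).
rewrite big1// => a _; case: forallP => // h.
case/negP: nbal; apply/forallP => j; apply/forallP => u; apply/forallP => v.
by rewrite (eqP (h (u, j))) (eqP (h (v, j))).
Qed.

Lemma sum_divisible_words (R : realType) (p s N : nat) (w : {ffun 'I_N -> 'I_s})
    (f : nat -> R) : (0 < p)%N ->
  [forall j, (p %| letter_count _ N w j)%N]%:R *
    \prod_j f (letter_count _ N w j %/ p)%N =
  \sum_(a : {ffun 'I_s -> 'I_N.+1})
     [forall j, letter_count _ N w j == (p * a j)%N]%:R * \prod_j f (a j).
Proof.
move=> p0; have [dv|ndv] := boolP [forall j, (p %| letter_count _ N w j)%N]; last first.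
  rewrite mul0r big1// => a _; case: forallP => [h|_]; last by rewrite mul0r.
  by case/negP: ndv; apply/forallP => j; rewrite (eqP (h j)) dvdn_mulr.
have lt j : (letter_count _ N w j %/ p < N.+1)%N.
  exact: leq_ltn_trans (leq_div _ _) (letter_count_ltn _ N w j).
rewrite (bigD1 [ffun j => Ordinal (lt j)])//= [X in _ = _ + X]big1 ?addr0 => [|a na].
  rewrite (_ : [forall _, _] = true).
    by congr (_ * _); apply: eq_bigr => j _; rewrite ffunE.
  apply/forallP => j; rewrite ffunE /= mulnC divnK//.
  exact: (forallP dv).
case: forallP => [h|_]; last by rewrite mul0r.
case/eqP: na; apply/ffunP => j; apply: val_inj; rewrite ffunE/=.
by rewrite (eqP (h j)) mulKn.
Qed.

Lemma balanced_words (R : realType) (p s N : nat) : (0 < p)%N -> (0 < s)%N ->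
  (\sum_r balanced p s N r)%N%:R / (p * s)%:R ^+ N =
  (\sum_(w : {ffun 'I_N -> 'I_s}) [forall j, (p %| letter_count _ N w j)%N]%:R *
    \prod_j balanced_proba R p (letter_count _ N w j %/ p)%N) / s%:R ^+ N.
Proof.
move=> p0 s0.
have pN : (p%:R ^+ N : R) != 0 by rewrite expf_neq0// pnatr_eq0 -lt0n.
have sN : (s%:R ^+ N : R) != 0 by rewrite expf_neq0// pnatr_eq0 -lt0n.
rewrite natrM exprMn.
rewrite (eq_bigr _ (fun w _ => sum_divisible_words R p s N w (balanced_proba R p) p0)).
rewrite (eq_bigr _ (fun r _ => balanced_sum p s N r p0)) exchange_big natr_sum /=.
rewrite [in RHS]exchange_big !mulr_suml; apply: eq_bigr => a _ /=.
rewrite -[in RHS]mulr_suml.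
have sumE : (\sum_(t : 'I_p * 'I_s) a t.2 = p * \sum_j a j)%N.
  rewrite -(pair_bigA _ (fun (u : 'I_p) (j : 'I_s) => a j : nat)) /=.
  by rewrite sum_nat_const card_ord.
have [aN|aN] := eqVneq (p * \sum_j a j)%N N; last first.
  rewrite count_words_eq0 ?sumE// mul0r -natr_sum.
  by rewrite (@count_words_eq0 _ _ (fun j => p * a j)%N) ?mul0r// -big_distrr.
have /(congr1 (fun n => n%:R : R)) :=
  count_words _ N (fun t : 'I_p * 'I_s => a t.2) (etrans sumE aN).
have aN' : (\sum_j p * a j = N)%N by rewrite -big_distrr.
have /(congr1 (fun n => n%:R : R)) := count_words _ N (fun j => p * a j)%N aN'.
rewrite -natr_sum !natrM => <-.
move: (\sum_(w : {ffun 'I_N -> 'I_p * 'I_s}) _)%N => K.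
move: (\sum_(w : {ffun 'I_N -> 'I_s}) _)%N => K'.
rewrite -(pair_bigA _ (fun (u : 'I_p) (j : 'I_s) => (a j)`!)) /=.
rewrite prod_nat_const card_ord natrX !natr_prod -prodrXl => e.
rewrite /balanced_proba big_split /= prodfV big_split/=.
have -> : \prod_(i < s) (p%:R : R) ^+ (p * a i) = p%:R ^+ N.
  by rewrite -[in RHS]aN' -expr_sum.
have f0 : \prod_(i < s) ((a i)`!%:R : R) ^+ p != 0.
  by apply/prodf_neq0 => i _; rewrite expf_neq0// pnatr_eq0 -lt0n fact_gt0.
by rewrite -[K%:R](mulfK f0) e; field; rewrite sN pN f0.
Qed.

(** * Words whose letter counts are divisible by [p] *)

(** [X^n - 1] is separable when [n] is invertible, so it has [n] distinct roots, and such a set of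
    roots contains a primitive one. *)
Lemma prim_root_exists (F : closedFieldType) (n : nat) :
  n%:R != 0 :> F -> exists z : F, n.-primitive_root z.
Proof.
move=> nF; have n_gt0 : (0 < n)%N by case: n nF => //; rewrite eqxx.
have [r Dp] := closed_field_poly_normal ('X^n - 1 : {poly F}).
rewrite (monicP _) ?monicXnsubC// scale1r in Dp.
have rn1 : all n.-unity_root r by apply/allP => z; rewrite -root_prod_XsubC -Dp.
have sz_r : (n < (size r).+1)%N.
  by rewrite -(size_prod_XsubC r id) -Dp size_XnsubC.
have [|z _ zn] := hasP (has_prim_root n_gt0 rn1 _ sz_r); last by exists z.
by rewrite -separable_prod_XsubC -Dp separable_Xn_sub_1.
Qed.

Lemma sum_prim_root_expr (F : fieldType) (p : nat) (z : F) (x : nat) :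
  p.-primitive_root z ->
  \sum_(b < p) z ^+ (b * x) = p%:R * (p %| x)%N%:R.
Proof.
move=> zp; have [px|px] := boolP (p %| x)%N.
  rewrite mulr1 -[in RHS](card_ord p) -sumr_const; apply: eq_bigr => b _.
  by apply/eqP; rewrite -(prim_order_dvd zp) dvdn_mull.
rewrite mulr0; apply/eqP; have y1 : z ^+ x - 1 != 0.
  by rewrite subr_eq0 -(prim_order_dvd zp).
rewrite -(mulrI_eq0 _ (mulfI y1)); apply/eqP.
under eq_bigr do rewrite mulnC exprM.
by rewrite -subrX1 -exprM mulnC exprM (prim_expr_order zp) expr1n subrr.
Qed.

(** Each divisibility indicator is expanded as a mean of characters. For a fixed tuple [b] the
    product over letters becomes a product over positions, and the sum over words factors into an
    [N]-th power. *)
Lemma sum_divisible_words_char (F : fieldType) (p s N : nat) (z : F) :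
  p.-primitive_root z ->
  p%:R ^+ s * \sum_(w : {ffun 'I_N -> 'I_s})
     [forall j, (p %| letter_count _ N w j)%N]%:R =
  \sum_(b : {ffun 'I_s -> 'I_p}) (\sum_(j < s) z ^+ b j) ^+ N.
Proof.
move=> zp; rewrite mulr_sumr.
transitivity (\sum_(w : {ffun 'I_N -> 'I_s}) \sum_(b : {ffun 'I_s -> 'I_p})
    \prod_(k < N) z ^+ b (w k)).
  apply: eq_bigr => w _.
  have -> : [forall j, (p %| letter_count _ N w j)%N]%:R =
      \prod_(j < s) (p %| letter_count _ N w j)%N%:R :> F.
    have [/forallP h|] := boolP [forall j, (p %| letter_count _ N w j)%N].
      by rewrite big1// => j _; rewrite h.
    rewrite negb_forall => /existsP[j /negbTE h].
    by rewrite (bigD1 j)//= h mul0r.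
  rewrite -[X in _ ^+ X](card_ord s) -prodr_const -big_split /=.
  under eq_bigr do rewrite -(sum_prim_root_expr _ _ _ _ zp).
  rewrite bigA_distr_bigA; apply: eq_bigr => b _.
  under eq_bigr do rewrite /letter_count big_distrr /= expr_sum.
  rewrite exchange_big; apply: eq_bigr => k _ /=.
  rewrite (bigD1 (w k))//= eqxx muln1 big1 ?mulr1// => j.
  by rewrite eq_sym => /negbTE ->; rewrite muln0 expr0.
rewrite exchange_big; apply: eq_bigr => b _ /=.
rewrite -[X in _ ^+ X](card_ord N) -prodr_const bigA_distr_bigA.
by apply: eq_bigr.
Qed.

(** Equality in the triangle inequality for unit terms would force all of them to be equal. *)
Lemma norm_sum_prim_root_lt (C : numClosedFieldType) (p s : nat) (z : C)
    (b : {ffun 'I_s -> 'I_p}) (i j : 'I_s) :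
  p.-primitive_root z -> b i != b j -> `|\sum_(j < s) z ^+ b j| < s%:R.
Proof.
move=> zp bij; have p0 := prim_order_gt0 zp.
have z1 : `|z| = 1.
  by apply/eqP; rewrite -(@pexpr_eq1 _ _ p)// -normrX (prim_expr_order zp) normr1.
have n1 k : `|z ^+ b k| = 1 by rewrite normrX z1 expr1n.
have sE : \sum_(k < s) `|z ^+ b k| = s%:R.
  by under eq_bigr do rewrite n1; rewrite sumr_const card_ord.
rewrite lt_neqAle -[X in _ <= X]sE ler_norm_sum andbT; apply: contra bij => /eqP.
rewrite -sE => /normC_sum_eq1 [k _|t _ e]; first exact: n1.
have /eqP := etrans (e i isT) (esym (e j isT)).
by rewrite (eq_prim_root_expr zp) !modn_small// => /eqP/val_inj/eqP.
Qed.

Lemma divisible_words_cvg (R : realType) (p s : nat) : (0 < p)%N -> (0 < s)%N ->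
  (\sum_(w : {ffun 'I_(p * n) -> 'I_s})
     [forall j, (p %| letter_count _ (p * n) w j)%N]%:R) / s%:R ^+ (p * n)
    @[n --> \oo] --> (p%:R / p%:R ^+ s : R).
Proof.
move=> p0 s0; pose j0 := Ordinal s0.
have [z zp] : exists z : R[i], p.-primitive_root z.
  by apply: prim_root_exists; rewrite pnatr_eq0 -lt0n.
pose F (b : {ffun 'I_s -> 'I_p}) := \sum_(j < s) z ^+ b j.
pose constant_ffun (b : {ffun 'I_s -> 'I_p}) := [forall j, b j == b j0].
(* The norm takes its values in [R[i]]; the real part brings it back to [R], where limits are
   taken. *)
pose rho b := complex.Re `|F b| / s%:R.
have rhoE b : `|F b / s%:R| = real_complex R (rho b).
  rewrite normrM normfV normr_nat /rho rmorphM fmorphV rmorph_nat.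
  congr (_ / _); apply/esym; exact: RRe_real (normr_real _).
have rho_ge0 b : 0 <= rho b by rewrite -lecR -rhoE normr_ge0.
have rho_lt1 b : ~~ constant_ffun b -> rho b < 1.
  rewrite negb_forall => /existsP[j bj].
  rewrite -ltcR -rhoE normrM normfV normr_nat ltr_pdivrMr ?ltr0n// mul1r.
  exact: norm_sum_prim_root_lt zp bj.
have ps0 : (p%:R ^+ s : R) != 0 by rewrite expf_neq0// pnatr_eq0 -lt0n.
pose d n : R := (\sum_(w : {ffun 'I_(p * n) -> 'I_s})
     [forall j, (p %| letter_count _ (p * n) w j)%N]%:R) / s%:R ^+ (p * n).
(* Constant tuples contribute [(s * z ^ b) ^ (p * n) = s ^ (p * n)], since [z ^ p = 1], and there
   are [p] of them. The error is the sum over the other tuples. *)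
have dE n : real_complex R (d n - p%:R / p%:R ^+ s) =
    (p%:R ^+ s)^-1 * \sum_(b | ~~ constant_ffun b) (F b / s%:R) ^+ (p * n).
  have sn0 : (s%:R ^+ (p * n) : R[i]) != 0 by rewrite expf_neq0// pnatr_eq0 -lt0n.
  have psC : (p%:R ^+ s : R[i]) != 0 by rewrite expf_neq0// pnatr_eq0 -lt0n.
  have := sum_divisible_words_char _ p s (p * n) z zp.
  rewrite (bigID constant_ffun) /=.
  have -> : \sum_(b : {ffun 'I_s -> 'I_p} | constant_ffun b)
       (\sum_(j < s) z ^+ b j) ^+ (p * n) = p%:R * s%:R ^+ (p * n).
    rewrite (eq_bigr (fun=> s%:R ^+ (p * n))) => [|b /forallP bc].
      rewrite sumr_const [RHS]mulr_natl; congr (_ *+ _).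
      pose f (k : 'I_p) := [ffun _ : 'I_s => k].
      have finj : injective f by move=> k l /ffunP/(_ j0); rewrite !ffunE.
      rewrite -[RHS](card_ord p) -(card_imset _ finj); apply: eq_card => b.
      rewrite unfold_in; apply/forallP/imsetP => [bc|[k _ ->] j]; last by rewrite !ffunE.
      by exists (b j0) => //; apply/ffunP => j; rewrite ffunE (eqP (bc j)).
    under eq_bigr do rewrite (eqP (bc _)).
    rewrite sumr_const card_ord -[X in X ^+ _]mulr_natl exprMn -exprM mulnCA.
    by rewrite [z ^+ (_ * _)]exprM (prim_expr_order zp) expr1n mulr1.
  move=> e; rewrite /d rmorphB !rmorphM !fmorphV !rmorphXn !rmorph_nat /= rmorph_sum /=.
  under eq_bigr do rewrite rmorph_nat.
  have -> : \sum_(b | ~~ constant_ffun b) (F b / s%:R) ^+ (p * n) =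
     (\sum_(b | ~~ constant_ffun b) (\sum_(j < s) z ^+ b j) ^+ (p * n)) / s%:R ^+ (p * n).
    by rewrite mulr_suml; apply: eq_bigr => b _; rewrite expr_div_n.
  rewrite -[X in _ = _ * (X / _)](addKr (p%:R * s%:R ^+ (p * n))) -e.
  move: (\sum_(i : {ffun 'I_(p * n) -> 'I_s}) _) (_ ^+ (p * n)) sn0 (_ ^+ s) psC.
  move=> a x x0 y y0.
  by field; rewrite y0 x0.
have d_le n : `|d n - p%:R / p%:R ^+ s| <=
    \sum_(b | ~~ constant_ffun b) rho b ^+ (p * n).
  rewrite -lecR.
  have -> : real_complex R `|d n - p%:R / p%:R ^+ s| =
      `|real_complex R (d n - p%:R / p%:R ^+ s)|.
    by rewrite normc_def /= expr0n addr0 sqrtr_sqr.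
  rewrite dE normrM; apply: le_trans (ler_piMl _ _) _ => //.
    rewrite normfV normrX normr_nat invf_le1 ?exprn_gt0 ?ltr0n//.
    by rewrite exprn_ege1// ler1n.
  apply: le_trans (ler_norm_sum _ _ _) _.
  by rewrite rmorph_sum/=; apply: ler_sum => b _; rewrite normrX rhoE rmorphXn.
have rho_cvg : \sum_(b | ~~ constant_ffun b) rho b ^+ (p * n) @[n --> \oo] --> (0 : R).
  suff : \sum_(b | ~~ constant_ffun b) rho b ^+ (p * n) @[n --> \oo] -->
      \sum_(b | ~~ constant_ffun b) (0 : R) by rewrite big1.
  apply: cvg_big => [|b bc]; first exact: add_continuous.
  under eq_fun do rewrite exprM.
  apply: cvg_expr; rewrite ger0_norm ?exprn_ge0//.
  by rewrite exprn_ilt1 ?rho_lt1// -lt0n.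
apply/cvgrPdist_le => /= e e0.
have /cvgrPdist_le/(_ e e0) := rho_cvg; apply: filterS => n.
rewrite sub0r normrN distrC => h; apply: le_trans (d_le n) _.
exact: le_trans (ler_norm _) h.
Qed.

(** * Concentration of the letter counts *)

Lemma expR_le_inv1D (R : realType) (x : R) : 0 <= x -> expR (- x) <= (1 + x)^-1.
Proof.
move=> x0; rewrite expRN lef_pV2 ?posrE ?expR_gt0 ?expR_ge1Dx//.
by rewrite (lt_le_trans ltr01)// lerDl.
Qed.

(* Chernoff's bound for the binomial law, with the exponential parameter [s * d / 2]. *)
Lemma letter_count_lower_tail (R : realType) (s N : nat) (j : 'I_s) (d : R) : 0 < d ->
  (\sum_(w : {ffun 'I_N -> 'I_s})
    ((letter_count _ N w j)%:R <= (s%:R^-1 - d) * N%:R :> R)%:R)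
     / s%:R ^+ N <= expR (- (s%:R * d ^+ 2 / 4) * N%:R).
Proof.
move=> d0; have s0 : (0 : R) < s%:R by rewrite ltr0n; case: s j => // -[].
pose l := s%:R * d / 2; have l0 : 0 <= l by rewrite divr_ge0// mulr_ge0// ltW.
rewrite ler_pdivrMr ?exprn_gt0//.
(* Exponential Markov inequality; the bounding product has independent factors, one per position. *)
have le1 w : ((letter_count _ N w j)%:R <= (s%:R^-1 - d) * N%:R :> R)%:R <=
    expR (l * ((s%:R^-1 - d) * N%:R)) * \prod_(k < N) expR (- l * (w k == j)%:R).
  rewrite -expR_sum -expRD -mulr_sumr -natr_sum mulNr -mulrBr.
  case: (boolP (_ <= (_ - d) * _)) => h; last exact: expR_ge0.
  by rewrite -[leLHS]expR0 ler_expR mulr_ge0// subr_ge0.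
apply: le_trans (ler_sum _ (fun w _ => le1 w)) _.
rewrite -mulr_sumr -(bigA_distr_bigA (fun (k : 'I_N) t => expR (- l * (t == j)%:R))).
rewrite prodr_const card_ord mulrA expRM_natr -!exprMn.
rewrite expRM_natr -exprMn lerXn2r ?nnegrE ?mulr_ge0 ?expR_ge0//.
  by apply: sumr_ge0 => *; exact: expR_ge0.
rewrite (bigD1 j)//= eqxx mulr1.
rewrite (eq_bigr (fun=> 1)) => [|t /negbTE->]; last by rewrite mulr0 expR0.
rewrite sumr_const.
have -> : #|(fun t : 'I_s => t != j)| = s.-1.
  by rewrite -[in RHS](card_ord s) -(cardC1 j); exact: eq_card.
have -> : (s.-1)%:R = s%:R - 1 :> R.
  by rewrite -subn1 natrB//; case: s j {s0 l l0 le1} => // -[].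
have -> : - (s%:R * d ^+ 2 / 4) = l * (s%:R^-1 - d) + (l ^+ 2 - l) / s%:R.
  by rewrite /l; field; rewrite gt_eqF.
rewrite expRD -[leRHS]mulrA ler_pM2l ?expR_gt0// -ler_pdivrMr//.
apply: le_trans (expR_ge1Dx _).
rewrite ler_pdivrMr// mulrDl mul1r divfK ?gt_eqF//.
(* This holds for every [l >= 0], because [(1 - l + l^2) (1 + l) = 1 + l^3], so [d] may be of any
   size. *)
suff : expR (- l) <= 1 - l + l ^+ 2 by lra.
apply: le_trans (expR_le_inv1D _ _ l0) _.
rewrite -div1r ler_pdivrMr; last by rewrite (lt_le_trans ltr01)// lerDl.
have -> : (1 - l + l ^+ 2) * (1 + l) = 1 + l ^+ 3 by ring.
by rewrite lerDl exprn_ge0.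
Qed.

Lemma exprn_expRN_cvg0 (R : realType) (m : nat) (c : R) : 0 < c ->
  n%:R ^+ m * expR (- c * n%:R) @[n --> \oo] --> (0 : R).
Proof.
(* The constant comes from [expR x >= x] at [x = c n / (m + 1)], raised to the power [m + 1]: one
   power of [n] is left to spare. *)
move=> c0; pose C : R := (m.+1%:R / c) ^+ m.+1.
apply: (@squeeze_cvgr _ _ _ _ (cst 0) (fun n => C * n%:R^-1)); last 2 first.
- exact: cvg_cst.
- suff : C * n%:R^-1 @[n --> \oo] --> C * 0 by rewrite mulr0.
  by apply: cvgMr; rewrite -(cvg_shiftS (fun n => n%:R^-1 : R)); exact: cvg_harmonic.
near=> n.
have n0 : (0 < n)%N by near: n; exact: nbhs_infty_gt.
have n0' : (0 : R) < n%:R by rewrite ltr0n.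
rewrite mulr_ge0 ?exprn_ge0 ?expR_ge0//= mulNr expRN.
rewrite ler_pdivrMr ?expR_gt0//.
have -> : expR (c * n%:R) = expR (c * n%:R / m.+1%:R) ^+ m.+1.
  by rewrite -expRM_natr divfK// pnatr_eq0.
have h : (c * n%:R / m.+1%:R) ^+ m.+1 <= expR (c * n%:R / m.+1%:R) ^+ m.+1.
  rewrite lerXn2r ?nnegrE ?expR_ge0//; first by rewrite divr_ge0// mulr_ge0// ltW.
  by apply: le_trans (expR_ge1Dx _); rewrite lerDr.
apply: le_trans (ler_wpM2l _ h); last first.
  by rewrite mulr_ge0 ?invr_ge0// exprn_ge0// divr_ge0// ltW.
rewrite /C mulrAC -exprMn.
have -> : m.+1%:R / c * (c * n%:R / m.+1%:R) = n%:R.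
  have : (m.+1%:R : R) != 0 by rewrite pnatr_eq0.
  by move: (m.+1%:R : R) => x x0; field; rewrite x0 gt_eqF.
by rewrite exprSr mulfK// gt_eqF.
Unshelve. all: by end_near. Qed.

(** The numerator over the factorials counts some of the [p ^ (p * a)] words. This crude bound
    serves for words whose counts are far from the mean. *)
Lemma balanced_proba_le1 (R : realType) (p a : nat) : (0 < p)%N ->
  0 <= balanced_proba R p a <= 1.
Proof.
move=> p0; rewrite divr_ge0//= ?mulr_ge0 ?exprn_ge0//.
rewrite ler_pdivrMr ?mulr_gt0 ?exprn_gt0 ?ltr0n ?fact_gt0// mul1r.
have /count_words : (\sum_(t < p) a = p * a)%N by rewrite sum_nat_const card_ord.
rewrite prod_nat_const card_ord => <-.
rewrite -!natrX -natrM ler_nat mulnC leq_pmul2l ?expn_gt0 ?fact_gt0//.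
rewrite (@leq_trans (\sum_(w : {ffun 'I_(p * a) -> 'I_p}) 1))//.
  by apply: leq_sum => w _; exact: leq_b1.
by rewrite sum1_card card_ffun !card_ord.
Qed.

Lemma prodr_near (R : realType) (s : nat) (k e : R) : 0 < k -> 0 < e ->
  exists2 h, 0 < h & forall x : 'I_s -> R,
    (forall j, `|x j - k| <= h) -> `|\prod_j x j - k ^+ s| <= e.
Proof.
move=> k0 e0; have /cvgrPdist_le/(_ e e0) := @exprn_continuous R s k.
move=> /nbhs_ballP[r /= r0 hr]; pose h := Num.min (r / 2) k.
have h0 : 0 < h by rewrite lt_min k0 divr_gt0.
have hk : h <= k by rewrite ge_min lexx orbT.
have hr2 : h < r by rewrite gt_min ltr_pdivrMr// ltr_pMr// ltr1n.
exists h => // x hx.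
have hx' j : 0 <= k - h <= x j /\ x j <= k + h.
  by have := hx j; rewrite ler_distl => /andP[-> ->]; rewrite subr_ge0 hk.
have lb : (k - h) ^+ s <= \prod_j x j.
  rewrite -[X in _ ^+ X](card_ord s) -prodr_const.
  by apply: ler_prod => j _; case: (hx' j).
have ub : \prod_j x j <= (k + h) ^+ s.
  rewrite -[X in _ ^+ X](card_ord s) -prodr_const.
  apply: ler_prod => j _; have [/andP[a b] ->] := hx' j.
  by rewrite (le_trans a b).
have /hr : ball k r (k + h) by rewrite /ball/= opprD addrA subrr sub0r normrN gtr0_norm.
have /hr : ball k r (k - h) by rewrite /ball/= opprB addrC subrK gtr0_norm.
rewrite /= ler_distlC => /andP[l1 _]; rewrite ler_distlC => /andP[_ l2].
by rewrite ler_distl (le_trans l1 lb) (le_trans ub l2).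
Qed.

(** The limit of [sqrt n ^ (p - 1) * balanced_proba R p a] when [a / n] tends to [1 / s]; the factor
    in [s] comes from [n] being about [s * a]. *)
Definition local_density (R : realType) (p s : nat) : R :=
  Num.sqrt s%:R ^+ p.-1 * (Num.sqrt p%:R / Num.sqrt (2 * pi) ^+ p.-1).

Lemma balanced_proba_local (R : realType) (p s : nat) (e : R) :
  (0 < p)%N -> (0 < s)%N -> 0 < e ->
  exists2 d : R, 0 < d & \forall n \near \oo, forall a : nat,
    `|a%:R / n%:R - s%:R^-1| <= d ->
    `|Num.sqrt n%:R ^+ p.-1 * balanced_proba R p a - local_density R p s| <= e.
Proof.
move=> p0 s0 e0; have s0' : (0 : R) < s%:R by rewrite ltr0n.
pose B a := Num.sqrt a%:R ^+ p.-1 * balanced_proba R p a.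
pose g (y : R) := Num.sqrt y^-1 ^+ p.-1.
have g_cvg : g y @[y --> (s%:R^-1 : R)] --> Num.sqrt s%:R ^+ p.-1.
  apply: (cvg_comp (fun y : R => Num.sqrt y^-1) (fun x => x ^+ p.-1)); last first.
    exact: exprn_continuous.
  apply: continuous_cvg; first exact: sqrt_continuous.
  suff : y^-1 @[y --> (s%:R^-1 : R)] --> (s%:R^-1^-1 : R) by rewrite invrK.
  by apply: cvgV => //; rewrite invr_eq0 gt_eqF.
(* The quantity factors through the ratio [a / n] and through [a]. A limit along the product filter
   makes the estimate uniform in [a]. *)
have gB_cvg : g x.1 * B x.2 @[x --> (nbhs (s%:R^-1 : R), nbhs \oo)] -->
    local_density R p s.
  apply: cvgM; first exact: (cvg_comp _ _ cvg_fst g_cvg).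
  exact: (cvg_comp _ _ cvg_snd (balanced_proba_cvg R p p0)).
have /cvgrPdist_le/(_ e e0) [[U V] /= [/nbhs_ballP[r /= r0 rU] [M _ MV]] UV] := gB_cvg.
(* The second bound forces [a / n >= 1 / (2 s)], so that [a] exceeds [M] as soon as [n > 2 s M]. *)
pose d := Num.min (r / 2) ((2 * s%:R)^-1).
have d0 : 0 < d by rewrite lt_min divr_gt0//= invr_gt0 mulr_gt0.
have dr : d < r by rewrite gt_min ltr_pdivrMr// ltr_pMr// ltr1n.
have ds : d <= (2 * s%:R)^-1 by rewrite ge_min lexx orbT.
exists d => //; exists (2 * s * M).+1 => // n /= nM a ad.
have n0 : (0 : R) < n%:R by rewrite ltr0n (leq_trans _ nM).
have an : (2 * s%:R)^-1 <= a%:R / n%:R :> R.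
  move: ad; rewrite ler_distl => /andP[+ _]; apply: le_trans.
  have -> : (2 * s%:R)^-1 = s%:R^-1 - (2 * s%:R)^-1 :> R.
    by field; rewrite gt_eqF.
  by rewrite lerD2l lerN2.
have aM : (M < a)%N.
  move: an; rewrite ler_pdivlMr// mulrC ler_pdivrMr ?mulr_gt0//.
  rewrite -!natrM ler_nat => h.
  have := leq_trans nM h.
  by rewrite mulnC ltn_pmul2r// muln_gt0.
have a0 : (0 : R) < a%:R by rewrite ltr0n (leq_ltn_trans _ aM).
have Uan : U (a%:R / n%:R).
  by apply: rU; rewrite /ball/= distrC (le_lt_trans ad).
have := UV (a%:R / n%:R, a) (conj Uan (MV a (ltnW aM))).
rewrite /= distrC; congr (`| _ - _| <= _).
by rewrite /g /B invf_div mulrA -exprMn -sqrtrM ?divfK ?gt_eqF//.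
Qed.

Lemma local_density_gt0 (R : realType) (p s : nat) : (0 < p)%N -> (0 < s)%N ->
  0 < local_density R p s.
Proof.
move=> p0 s0; have pi0 := @pi_gt0 R.
by rewrite mulr_gt0 ?divr_gt0 ?exprn_gt0 ?sqrtr_gt0 ?ltr0n// mulr_gt0.
Qed.

(** Lower bounds suffice: the counts sum to [N], so a count is at most [N] minus the lower bounds of
    the others. Dividing [d] by [s] absorbs the [s - 1] deviations that add up. *)
Lemma letter_count_near (R : realType) (s N : nat) (w : {ffun 'I_N -> 'I_s}) (d : R) :
  (0 < N)%N -> 0 < d ->
  (forall j, (s%:R^-1 - d / s%:R) * N%:R < (letter_count _ N w j)%:R) ->
  forall j, `|(letter_count _ N w j)%:R / N%:R - s%:R^-1| <= d.
Proof.
move=> N0 d0 lb j.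
have s0 : (0 < s)%N by case: s w lb j => // w lb -[].
have s0' : (0 : R) < s%:R by rewrite ltr0n.
have s1 : (1 : R) <= s%:R by rewrite ler1n.
have N0' : (0 : R) < N%:R by rewrite ltr0n.
have /(congr1 (fun n => n%:R : R)) := sum_letter_count _ N w.
rewrite natr_sum (bigD1 j)//= => /(canRL (addrK _)) e.
rewrite ler_distl ler_pdivlMr// ler_pdivrMr//; apply/andP; split.
  apply: le_trans (ltW (lb j)); rewrite ler_wpM2r ?(ltW N0')// lerD2l lerN2.
  by rewrite ler_pdivrMr// ler_peMr// ltW.
rewrite e lerBlDr -lerBlDl.
have : \sum_(i < s | i != j) (s%:R^-1 - d / s%:R) * N%:R <=
       \sum_(i < s | i != j) ((letter_count _ N w i)%:R : R).
  by apply: ler_sum => i _; exact: ltW.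
apply: le_trans; rewrite sumr_const.
have -> : #|(fun i : 'I_s => i != j)| = s.-1.
  by rewrite -[in RHS](card_ord s) -(cardC1 j); exact: eq_card.
rewrite -[leRHS]mulr_natl.
have -> : (s.-1)%:R = s%:R - 1 :> R by rewrite -subn1 natrB.
have -> : (s%:R - 1) * ((s%:R^-1 - d / s%:R) * N%:R) =
  N%:R - (s%:R^-1 + d) * N%:R + d / s%:R * N%:R by field; rewrite gt_eqF.
by rewrite lerDl mulr_ge0 ?divr_ge0// ltW.
Qed.

Lemma balanced_words_cvg (R : realType) (p s : nat) : (0 < p)%N -> (0 < s)%N ->
  Num.sqrt n%:R ^+ (p.-1 * s) *
    ((\sum_(w : {ffun 'I_(p * n) -> 'I_s})
        [forall j, (p %| letter_count _ (p * n) w j)%N]%:R *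
        \prod_j balanced_proba R p (letter_count _ (p * n) w j %/ p)%N) /
     s%:R ^+ (p * n))
  @[n --> \oo] --> p%:R / p%:R ^+ s * local_density R p s ^+ s.
Proof.
move=> p0 s0; have s0' : (0 : R) < s%:R by rewrite ltr0n.
have k0 := local_density_gt0 R p s p0 s0; set k := local_density R p s in k0 *.
pose S n : R := Num.sqrt n%:R ^+ (p.-1 * s).
pose dv n (w : {ffun 'I_(p * n) -> 'I_s}) :=
  [forall j, (p %| letter_count _ (p * n) w j)%N].
pose f n (w : {ffun 'I_(p * n) -> 'I_s}) :=
  \prod_j balanced_proba R p (letter_count _ (p * n) w j %/ p)%N.
have S_ge0 n : 0 <= S n by rewrite exprn_ge0.
have f01 n w : 0 <= f n w <= 1.
  apply/andP; split.
    apply: prodr_ge0 => j _.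
    by have /andP[] := balanced_proba_le1 R p (letter_count _ (p * n) w j %/ p) p0.
  apply: prodr_ile1 => j _; exact: balanced_proba_le1.
pose G n : R := (\sum_w (dv n w)%:R * f n w) / s%:R ^+ (p * n).
pose D n : R := (\sum_w (dv n w)%:R) / s%:R ^+ (p * n).
suff diff_cvg : S n * G n - D n * k ^+ s @[n --> \oo] --> (0 : R).
  have E : (fun n => S n * G n) = (fun n => S n * G n - D n * k ^+ s + D n * k ^+ s).
    by apply/funext => n; rewrite subrK.
  rewrite -[X in X @ _ --> _]/(fun n => S n * G n) E -[_ * k ^+ s]add0r.
  apply: cvgD diff_cvg _; apply: cvgM (cvg_cst _).
  exact: divisible_words_cvg.
apply/cvgrPdist_le => /= e e0.
have [h h0 prod_le] := prodr_near R s k (e / 2) k0 (divr_gt0 e0 (ltr0Sn R 1)).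
have [d d0 loc] := balanced_proba_local R p s h p0 s0 h0.
(* The rate given by the tail bound for deviation [d / s] and length [p * n]. *)
pose c := s%:R * (d / s%:R) ^+ 2 / 4 * p%:R.
have c0 : 0 < c by rewrite !mulr_gt0 ?exprn_gt0 ?divr_gt0 ?ltr0n ?invr_gt0.
have tail_cvg : s%:R * (n%:R ^+ (p.-1 * s) * expR (- c * n%:R)
   + k ^+ s * (n%:R ^+ 0 * expR (- c * n%:R))) @[n --> \oo] --> (0 : R).
  suff : s%:R * (n%:R ^+ (p.-1 * s) * expR (- c * n%:R)
   + k ^+ s * (n%:R ^+ 0 * expR (- c * n%:R))) @[n --> \oo] -->
      s%:R * (0 + k ^+ s * 0 : R).
    by rewrite mulr0 addr0 mulr0.
  by apply: cvgMr; apply: cvgD; [|apply: cvgMr]; exact: exprn_expRN_cvg0.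
have /cvgrPdist_le/(_ (e / 2) (divr_gt0 e0 (ltr0Sn R 1))) tail_near := tail_cvg.
near=> n.
have n0 : (0 < n)%N by near: n; exact: nbhs_infty_gt.
have N0 : (0 < p * n)%N by rewrite muln_gt0 p0.
have loc_n : forall a : nat, `|a%:R / n%:R - s%:R^-1| <= d ->
    `|Num.sqrt n%:R ^+ p.-1 * balanced_proba R p a - local_density R p s| <= h.
  by near: n; exact: loc.
have tail_n : s%:R * (S n + k ^+ s) * expR (- c * n%:R) <= e / 2.
  have : `|0 - s%:R * (n%:R ^+ (p.-1 * s) * expR (- c * n%:R)
   + k ^+ s * (n%:R ^+ 0 * expR (- c * n%:R)))| <= e / 2 by near: n.
  rewrite sub0r normrN => /(le_trans (ler_norm _)); apply: le_trans.
  rewrite expr0 mul1r -mulrDl -mulrA ler_wpM2l ?(ltW s0')//.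
  rewrite ler_wpM2r ?expR_ge0// lerD2r lerXn2r ?nnegrE//.
  rewrite -[leRHS]sqr_sqrtr// expr2 ler_peMl//.
  by rewrite -[leLHS]sqrtr1 ler_sqrt// ler1n.
have sN0 : (0 : R) < s%:R ^+ (p * n) by rewrite exprn_gt0.
pose bad (w : {ffun 'I_(p * n) -> 'I_s}) j := ((letter_count _ (p * n) w j)%:R <=
   (s%:R^-1 - d / s%:R) * (p * n)%:R :> R).
(* On divisible words without a bad letter the product is within [e / 2] of [k ^ s]. A bad word
   costs at most [S n + k ^ s], charged to its bad letters. *)
have pointwise w : `|S n * ((dv n w)%:R * f n w) - (dv n w)%:R * k ^+ s| <=
    e / 2 + (S n + k ^+ s) * \sum_j (bad w j)%:R.
  have Sk0 : 0 <= S n + k ^+ s by rewrite addr_ge0// exprn_ge0// ltW.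
  have e20 : 0 <= e / 2 by rewrite divr_ge0// ltW.
  have bad0 : 0 <= \sum_j (bad w j)%:R :> R by rewrite sumr_ge0.
  have [dvw|_] := boolP (dv n w); last first.
    by rewrite !mul0r mulr0 subrr normr0 addr_ge0// mulr_ge0.
  rewrite !mul1r.
  have [/existsP[j badj]|nbad] := boolP [exists j, bad w j].
    apply: (@le_trans _ _ (S n + k ^+ s)).
      apply: le_trans (ler_normB _ _) _; have /andP[f0 f1] := f01 n w.
      rewrite !ger0_norm ?mulr_ge0 ?exprn_ge0 ?(ltW k0)// lerD2r.
      by rewrite ler_piMr.
    rewrite -[leLHS]add0r lerD// ler_peMr// (bigD1 j)//= badj lerDl.
    by rewrite sumr_ge0.
  apply: (@le_trans _ _ (e / 2)); last by rewrite lerDl mulr_ge0.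
  have -> : S n * f n w = \prod_j (Num.sqrt n%:R ^+ p.-1 *
      balanced_proba R p (letter_count _ (p * n) w j %/ p)%N).
    by rewrite big_split /= prodr_const card_ord -exprM.
  apply: prod_le => j; apply: loc_n.
  have -> : (letter_count _ (p * n) w j %/ p)%:R / n%:R =
     (letter_count _ (p * n) w j)%:R / (p * n)%:R :> R.
    have /forallP/(_ j)/divnK {2}<- := dvw.
    by rewrite !natrM; field; rewrite !pnatr_eq0 -!lt0n n0 p0.
  apply: letter_count_near => // i.
  by move: nbad; rewrite negb_exists => /forallP/(_ i); rewrite -ltNge.
rewrite sub0r normrN.
have -> : S n * G n - D n * k ^+ s =
    (\sum_w (S n * ((dv n w)%:R * f n w) - (dv n w)%:R * k ^+ s)) / s%:R ^+ (p * n).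
  rewrite big_split /= sumrN -mulr_sumr -mulr_suml /G /D; field.
  by rewrite gt_eqF.
rewrite normrM normfV (ger0_norm (ltW sN0)).
apply: (@le_trans _ _
  ((\sum_w (e / 2 + (S n + k ^+ s) * \sum_j (bad w j)%:R)) / s%:R ^+ (p * n))).
  rewrite ler_wpM2r ?invr_ge0 ?(ltW sN0)//.
  by apply: le_trans (ler_norm_sum _ _ _) _; apply: ler_sum => w _; exact: pointwise.
rewrite big_split /= sumr_const card_ffun !card_ord -[X in (X + _) / _]mulr_natr.
rewrite natrX mulrDl mulfK ?gt_eqF// -mulr_sumr exchange_big /= -mulrA mulr_suml.
have tail j : (\sum_w (bad w j)%:R) / s%:R ^+ (p * n) <= expR (- c * n%:R) :> R.
  have -> : - c * n%:R = - (s%:R * (d / s%:R) ^+ 2 / 4) * (p * n)%:R.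
    by rewrite /c natrM; ring.
  exact: letter_count_lower_tail (divr_gt0 d0 s0').
have : \sum_j (\sum_w (bad w j)%:R) / s%:R ^+ (p * n) <= s%:R * expR (- c * n%:R) :> R.
  apply: le_trans (ler_sum _ (fun j _ => tail j)) _.
  by rewrite sumr_const card_ord mulr_natl.
have Sk0 : 0 <= S n + k ^+ s by rewrite addr_ge0// exprn_ge0// ltW.
move=> /(ler_wpM2l Sk0); rewrite mulrA [_ * s%:R]mulrC => /le_trans/(_ tail_n).
lra.
Unshelve. all: by end_near. Qed.

(** * Vanishing sums of roots of unity *)

Section ZeroSums.
Variables (C : numClosedFieldType) (p k : nat) (p_prime : prime p) (z : C).
Let s := (p ^ k)%N.
Hypothesis z_prim : (p ^ k.+1).-primitive_root z.

(** The sum is the cyclotomic polynomial of [p ^ k.+1] at [y]. If [y] has order [p ^ j] with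
    [j <= k], every term is 1 and the sum is [p]. *)
Lemma sum_prim_root_step (F : fieldType) (y : F) : p%:R != 0 :> F ->
  (\sum_(u < p) y ^+ (s * u) == 0) = (p ^ k.+1).-primitive_root y.
Proof.
move=> pF; apply/eqP/idP => [y0|y_prim].
  have yq : y ^+ (p ^ k.+1) = 1.
    apply/eqP; rewrite -subr_eq0 expnSr exprM subrX1.
    by under eq_bigr do rewrite -exprM; rewrite y0 mulr0.
  have q0 : (0 < p ^ k.+1)%N by rewrite expn_gt0 prime_gt0.
  have [m m_prim /dvdn_pfactor[//|j jk mE]] := prim_order_exists q0 yq.
  move: jk; rewrite leq_eqVlt => /predU1P[jk|jk]; first by rewrite -jk -mE.
  case/eqP: pF; rewrite -y0 -[X in X%:R](card_ord p) -sumr_const.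
  apply: eq_bigr => u _; apply/esym/eqP.
  by rewrite -(prim_order_dvd m_prim) mE dvdn_mulr// dvdn_exp2l.
apply/eqP; have ys1 : y ^+ s - 1 != 0.
  rewrite subr_eq0 -(prim_order_dvd y_prim) dvdn_Pexp2l ?prime_gt1//.
  by rewrite -ltnNge.
apply/eqP/(mulfI ys1); rewrite mulr0; under eq_bigr do rewrite exprM.
by rewrite -subrX1 -exprM -expnSr (prim_expr_order y_prim) subrr.
Qed.

(** [s * p.-1] is the totient of [p ^ k.+1], and the bound on the size says that the degree is
    strictly smaller. *)
Lemma poly_prim_root_eq0 (f : {poly rat}) :
  (size f <= s * p.-1)%N -> root (map_poly ratr f) z -> f = 0.
Proof.
move=> sf fz; apply/eqP/negPn/negP => f0.
(* The gcd [g] of [f] and the cyclotomic polynomial [Phi] vanishes at [z], hence has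
   a root [y] in [algC], where minimal polynomials of roots of unity are known. *)
pose Phi : {poly rat} := \sum_(u < p) 'X^(s * u).
have PhiE (D : numFieldType) (y : D) :
    root (map_poly ratr Phi) y = (p ^ k.+1).-primitive_root y.
  rewrite -sum_prim_root_step ?pnatr_eq0 -?lt0n ?prime_gt0// rootE rmorph_sum horner_sum.
  by under eq_bigr do rewrite /= map_polyXn hornerXn.
pose g := gcdp Phi f.
have gz : root (map_poly ratr g) z.
  by rewrite gcdp_map root_gcd PhiE z_prim.
have g0 : g != 0 by rewrite gcdp_eq0 negb_and f0 orbT.
have : size (map_poly (ratr : rat -> algC) g) != 1%N.
  rewrite size_map_poly -(size_map_poly (ratr : rat -> C)) gtn_eqF//.
  by rewrite (root_size_gt1 _ gz)// map_poly_eq0.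
move=> /closed_rootP[y]; rewrite gcdp_map root_gcd PhiE => /andP[y_prim fy].
have [m [mE _] /(_ f)] := minCpolyP y; rewrite fy => /esym mf.
have : size (minCpoly y) = (totient (p ^ k.+1)).+1.
  by rewrite (minCpoly_cyclotomic y_prim) size_cyclotomic.
rewrite mE size_map_poly totient_pfactor//= mulnC => sm.
by have := leq_trans (dvdp_leq f0 mf) sf; rewrite sm ltnn.
Qed.

Definition phase_exponent (t : 'I_p * 'I_s) : nat := (s * t.1 + t.2)%N.

Lemma phase_exponent_inj : injective phase_exponent.
Proof.
move=> [u i] [v j] /=; rewrite /phase_exponent /= => e.
have s0 : (0 < s)%N by rewrite expn_gt0 prime_gt0.
have ij : i = j :> nat.
  by have /(congr1 (modn^~ s)) := e; rewrite !(mulnC s) !modnMDl !modn_small.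
move: e; rewrite ij => /addIn/eqP; rewrite eqn_pmul2l// => /eqP uv.
by congr (_, _); apply: val_inj.
Qed.

Lemma sum_phases (N : nat) (r : {ffun 'I_N -> 'I_p * 'I_s}) :
  \sum_(i < N) z ^+ phase_exponent (r i) =
  \sum_t (letter_count _ N r t)%:R * z ^+ phase_exponent t.
Proof.
rewrite /letter_count; under [RHS]eq_bigr do rewrite natr_sum mulr_suml.
rewrite exchange_big; apply: eq_bigr => i _ /=.
rewrite (bigD1 (r i))//= eqxx mul1r big1 ?addr0// => t.
by rewrite eq_sym => /negbTE ->; rewrite mul0r.
Qed.

(** Within each class the common factor [z ^ j] comes out, leaving the full sum of [p]-th roots of
    unity. *)
Lemma sum_periodic_phases (c : 'I_s -> C) :
  \sum_(t : 'I_p * 'I_s) c t.2 * z ^+ phase_exponent t = 0.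
Proof.
rewrite -(pair_bigA _ (fun u j => c j * z ^+ phase_exponent (u, j))) /=.
rewrite exchange_big big1// => j _ /=.
rewrite /phase_exponent /=; under eq_bigr do rewrite exprD mulrCA.
rewrite -mulr_suml; apply/eqP; rewrite mulf_eq0.
by rewrite sum_prim_root_step ?z_prim// pnatr_eq0 -lt0n prime_gt0.
Qed.

Lemma sum_phases_eq0 (N : nat) (r : {ffun 'I_N -> 'I_p * 'I_s}) :
  (\sum_(i < N) z ^+ phase_exponent (r i) == 0) = balanced p s N r.
Proof.
have p0 := prime_gt0 p_prime; rewrite sum_phases.
have lt_last : (p.-1 < p)%N by rewrite prednK.
pose last := Ordinal lt_last.
apply/eqP/idP => [e|/forallP bal]; last first.
  rewrite -[RHS](sum_periodic_phases (fun j => (letter_count _ N r (last, j))%:R)).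
  apply: eq_bigr => -[u j] _ /=.
  by have /forallP/(_ u)/forallP/(_ last)/eqP-> := bal j.
(* Subtracting the counts of the top block [u = p - 1] changes the sum by a vanishing periodic one
   and removes all exponents from [s * p.-1] on. The resulting polynomial is short enough to be
   forced to 0. *)
pose c t : rat := (letter_count _ N r t)%:R - (letter_count _ N r (last, t.2))%:R.
pose f : {poly rat} := \sum_t c t *: 'X^(phase_exponent t).
have f0 : f = 0.
  apply: poly_prim_root_eq0.
    apply: (leq_trans (size_sum _ _ _)); apply/bigmax_leqP => -[u j] _.
    have [->|ul] := eqVneq u last; first by rewrite /c subrr scale0r size_poly0.
    apply: (leq_trans (size_scale_leq _ _)); rewrite size_polyXn /phase_exponent /=.
    apply: (@leq_trans (s * u.+1)); first by rewrite mulnS addnC ltn_add2r.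
    have := ltn_ord u; rewrite -[X in (_ < X)%N](prednK p0) ltnS leq_eqVlt.
    move=> /predU1P[up|up]; last by rewrite leq_mul2l up orbT.
    by case/eqP: ul; exact: val_inj.
  rewrite rootE rmorph_sum horner_sum.
  under eq_bigr do
    rewrite /= map_polyZ map_polyXn hornerZ hornerXn /c rmorphB !rmorph_nat mulrBl.
  rewrite sumrB e sub0r.
  by rewrite (sum_periodic_phases (fun j => (letter_count _ N r (last, j))%:R)) oppr0.
have cE t : letter_count _ N r t = letter_count _ N r (last, t.2).
  have := congr1 (fun h : {poly rat} => h`_(phase_exponent t)) f0.
  rewrite coef0 coef_sum (bigD1 t)//= coefZ coefXn eqxx mulr1 big1 ?addr0.
    by move=> /eqP; rewrite subr_eq0 eqr_nat => /eqP.
  move=> t' t't; rewrite coefZ coefXn.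
  by rewrite (inj_eq phase_exponent_inj) eq_sym (negbTE t't) mulr0.
apply/forallP => j; apply/forallP => u; apply/forallP => v.
by rewrite cE [X in _ == X]cE.
Qed.
End ZeroSums.

(** * Counting partial Butson matrices *)

Lemma dotmx_rowE (C : numClosedFieldType) (M N : nat) (H : 'M[C]_(M, N)) (i j : 'I_M) :
  dotmx (row i H) (row j H) = \sum_k H i k * (H j k)^*.
Proof. by rewrite dotmxE !mxE; apply: eq_bigr => k _; rewrite !mxE. Qed.

Section Count.
Variables (R : realType) (p k N : nat) (p_prime : prime p) (z : R[i]).
Let s := (p ^ k)%N.
Hypothesis z_prim : (p ^ k.+1).-primitive_root z.
Let T : finType := ('I_p * 'I_s)%type.
Let e (t : T) : R[i] := z ^+ phase_exponent p k t.

Lemma phase_exponent_lt (t : T) : (phase_exponent p k t < p ^ k.+1)%N.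
Proof.
case: t => u j; rewrite expnSr /phase_exponent /=; apply: (@leq_trans (s * u.+1)).
  by rewrite mulnS addnC ltn_add2r.
by rewrite leq_mul2l ltn_ord orbT.
Qed.

Lemma phase_inj : injective e.
Proof.
move=> t t' /eqP; rewrite (eq_prim_root_expr z_prim) !modn_small ?phase_exponent_lt//.
by move=> /eqP; apply: phase_exponent_inj.
Qed.

Lemma phase_surj (x : R[i]) : x ^+ (p ^ k.+1) = 1 -> exists t, e t = x.
Proof.
have s0 : (0 < s)%N by rewrite expn_gt0 prime_gt0.
move=> /(prim_rootP z_prim)[i ->].
have i1 : (i %/ s < p)%N by rewrite ltn_divLR// -expnS.
have i2 : (i %% s < s)%N by rewrite ltn_mod.
by exists (Ordinal i1, Ordinal i2); rewrite /e /phase_exponent/= mulnC -divn_eq.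
Qed.

Lemma phase_unity t : e t ^+ (p ^ k.+1) = 1.
Proof. by rewrite /e exprAC (prim_expr_order z_prim) expr1n. Qed.

(** Multiplying a row entrywise by the conjugate of [y] permutes the words, so the count is the same
    for every [y]. *)
Lemma sum_orthogonal_words (y : {ffun 'I_N -> T}) :
  (\sum_(x : {ffun 'I_N -> T}) (\sum_i e (x i) * (e (y i))^* == 0)%R
   = \sum_r balanced p s N r)%N.
Proof.
pose m (t t' : T) := odflt t [pick u | e u == e t * (e t')^*].
have mE t t' : e (m t t') = e t * (e t')^*.
  rewrite /m; case: pickP => [u /eqP//|/= h].
  have [|u eu] := phase_surj (e t * (e t')^*).
    by rewrite exprMn -rmorphXn !phase_unity rmorph1 mulr1.
  by have := h u; rewrite eu eqxx.
pose M (x : {ffun 'I_N -> T}) := [ffun i => m (x i) (y i)].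
have e0 t : e t != 0.
  apply/eqP => et; have := phase_unity t; rewrite et expr0n.
  by rewrite expn_eq0 -[p == _]negbK -lt0n prime_gt0//= => /esym/eqP; rewrite oner_eq0.
have M_inj : injective M.
  move=> x x' /ffunP h; apply/ffunP => i; apply: phase_inj.
  have := congr1 e (h i); rewrite !ffunE !mE => /mulIf; apply.
  by rewrite conjC_eq0.
rewrite [RHS](reindex_inj M_inj); apply: eq_bigr => x _.
rewrite -(sum_phases_eq0 _ p k p_prime z z_prim).
by congr (nat_of_bool (_ == 0)); apply: eq_bigr => i _; rewrite ffunE -mE.
Qed.

Lemma card_partial_butson :
  #|` fset_set (@partial_butson R (p ^ k.+1) 2 N)| =
  ((p * s) ^ N * \sum_r balanced p s N r)%N.
Proof.
have q0 : (0 < p ^ k.+1)%N by rewrite expn_gt0 prime_gt0.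
pose W := {ffun 'I_N -> T}.
pose A := [set xy : W * W | \sum_i e (xy.1 i) * (e (xy.2 i))^* == 0]%SET.
pose g (xy : W * W) : 'M[R[i]]_(2, N) :=
  \matrix_(i, j) e (if i == 0 then xy.1 j else xy.2 j).
have g_inj : injective g.
  move=> [x y] [x' y'] /matrixP h; congr (_, _); apply/ffunP => j; apply: phase_inj.
    by have := h 0 j; rewrite !mxE.
  by have := h 1 j; rewrite !mxE.
have -> : fset_set (@partial_butson R (p ^ k.+1) 2 N) = [fset g xy | xy in A]%fset.
  apply/fsetP => H; rewrite in_fset_set; last exact: finite_partial_butson.
  apply/idP/imfsetP => /=.
    rewrite in_setE => -[/mxOverP HU Ho].
    have ex i j : exists t, e t == H i j.
      have /phase_surj[t et] : H i j ^+ (p ^ k.+1) = 1 by apply/unity_rootP; exact: HU.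
      by exists t; rewrite et.
    pose x i : W := [ffun j => xchoose (ex i j)].
    have xE i j : e (x i j) = H i j.
      by rewrite ffunE; apply/eqP; exact: (xchooseP (ex i j)).
    exists (x 0, x 1).
      rewrite inE /=; under eq_bigr do rewrite !xE.
      by rewrite -dotmx_rowE Ho.
    apply/matrixP => i j; rewrite mxE -xE; congr (e _).
    by have /orP[/eqP->|/eqP->] : (i == 0) || (i == 1) by case: i => -[|[|]].
  move=> [[x y]]; rewrite inE /= => xy0 ->; rewrite in_setE; split.
    by apply/mxOverP => i j; rewrite mxE; apply/unity_rootP; exact: phase_unity.
  have {}xy0 := eqP xy0.
  have ord2 (i : 'I_2) : i = 0 \/ i = 1.
    by case: i => -[|[|//]] ?; [left|right]; exact: val_inj.
  move=> i j ij; rewrite dotmx_rowE; under eq_bigr do rewrite !mxE.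
  move: ij; case: (ord2 i) => ->; case: (ord2 j) => -> //= _.
  (* [A] only records orthogonality of row 0 to row 1; the reverse order is its complex
     conjugate. *)
  transitivity ((\sum_l e (x l) * (e (y l))^*)^*); last by rewrite xy0 conjC0.
  rewrite rmorph_sum /=; apply: eq_bigr => l _.
  by rewrite rmorphM /= conjCK mulrC.
rewrite card_imfset//= -cardE -sum1_card.
transitivity (\sum_(y : W) \sum_(x : W) (\sum_i e (x i) * (e (y i))^* == 0)%R)%N.
  rewrite exchange_big pair_big /= big_mkcond; apply: eq_bigr => xy _ /=.
  by rewrite inE; case: ifP.
rewrite (eq_bigr _ (fun y _ => sum_orthogonal_words y)).
by rewrite sum_nat_const card_ffun card_prod !card_ord.
Qed.
End Count.

(** * Asymptotics of the probability *)

(** The free choice of the second row cancels one of the two factors [q ^ N]. *)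
Lemma butson_proba2E (R : realType) (p k N : nat) : prime p ->
  butson_proba R (p ^ k.+1) 2 N =
  (\sum_(r : {ffun 'I_N -> 'I_p * 'I_(p ^ k)}) balanced p (p ^ k) N r)%N%:R /
    (p * p ^ k)%:R ^+ N.
Proof.
move=> p_prime; have [z z_prim] : exists z : R[i], (p ^ k.+1).-primitive_root z.
  by apply: prim_root_exists; rewrite pnatr_eq0 -lt0n expn_gt0 prime_gt0.
rewrite /butson_proba (card_partial_butson _ _ _ _ p_prime z z_prim) -expnS.
have : ((p ^ k.+1)%N%:R ^+ N : R) != 0.
  by rewrite expf_neq0// pnatr_eq0 -lt0n expn_gt0 prime_gt0.
rewrite natrM [X in X * _ / _]natrX mul2n -addnn exprD.
by move: ((p ^ k.+1)%N%:R ^+ N) => x x0; field.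
Qed.

Lemma butson_proba2_cvg (R : realType) (p k : nat) : prime p ->
  Num.sqrt n%:R ^+ (p.-1 * p ^ k) * butson_proba R (p ^ k.+1) 2 (p * n)
  @[n --> \oo] -->
    (p%:R / p%:R ^+ (p ^ k) * local_density R p (p ^ k) ^+ (p ^ k) : R).
Proof.
move=> p_prime; have p0 := prime_gt0 p_prime.
have s0 : (0 < p ^ k)%N by rewrite expn_gt0 p0.
under eq_fun do rewrite (butson_proba2E _ _ _ _ p_prime) (balanced_words R _ _ _ p0 s0).
exact: balanced_words_cvg.
Qed.

Lemma cvg_within_dvdn (T : topologicalType) (p : nat) (f : nat -> T) (l : T) :
  (0 < p)%N -> f (p * n)%N @[n --> \oo] --> l ->
  f N @[N --> within [set N : nat | (p %| N)%N] \oo] --> l.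
Proof.
move=> p0 fl U /fl[M _ MU]; exists (p * M)%N => // N /= MN /dvdnP[n Nn].
by rewrite Nn mulnC; apply: MU; move: MN; rewrite /= Nn mulnC leq_pmul2r.
Qed.

(** With [q = p * s] and [N = p * n] the stated equivalent is exactly the limit constant over the
    normalisation; both sides are nonnegative, so their squares are compared. *)
Lemma butson_asymptoticE (R : realType) (p s n : nat) :
  (0 < p)%N -> (0 < s)%N -> (0 < n)%N ->
  Num.sqrt ((p%:R ^ (2 - s%:Z) * (p * s)%:R ^+ (p.-1 * s))
            / (2 * pi * (p * n)%:R) ^+ (p.-1 * s)) =
  p%:R / p%:R ^+ s * local_density R p s ^+ s / Num.sqrt n%:R ^+ (p.-1 * s).
Proof.
move=> p0 s0 n0; have pi0 := @pi_gt0 R.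
have p0' : (0 : R) < p%:R by rewrite ltr0n.
have s0' : (0 : R) < s%:R by rewrite ltr0n.
have n0' : (0 : R) < n%:R by rewrite ltr0n.
have k0 := local_density_gt0 R p s p0 s0.
set rhs := (RHS).
have rhs0 : 0 <= rhs.
  by rewrite !mulr_ge0 ?invr_ge0 ?exprn_ge0// ltW.
rewrite -[RHS](ger0_norm rhs0) -sqrtr_sqr; congr Num.sqrt.
set m := (p.-1 * s)%N.
have density2 : local_density R p s ^+ s ^+ 2 =
    s%:R ^+ m * (p%:R ^+ s / (2 * pi) ^+ m).
  rewrite exprAC.
  have -> : local_density R p s ^+ 2 = s%:R ^+ p.-1 * (p%:R / (2 * pi) ^+ p.-1).
    rewrite /local_density [LHS]exprMn [X in _ * X]expr_div_n.
    rewrite ![_ ^+ p.-1 ^+ 2]exprAC !sqr_sqrtr//.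
    by rewrite mulr_ge0// ltW.
  by rewrite exprMn expr_div_n -!exprM.
have n2 : Num.sqrt (n%:R : R) ^+ m ^+ 2 = n%:R ^+ m by rewrite exprAC sqr_sqrtr.
rewrite /rhs expr_div_n [X in _ = X / _]exprMn density2 n2 [X in _ = X * _ / _]expr_div_n.
have -> : (p%:R : R) ^ (2 - s%:Z) = p%:R ^+ 2 / p%:R ^+ s.
  by rewrite expfzDr ?gt_eqF// -exprnN.
rewrite !natrM !exprMn.
have xm0 (x : R) j : 0 < x -> x ^+ j != 0 by move=> x0; rewrite gt_eqF ?exprn_gt0.
have ps0 := xm0 _ s p0'; have pm0 := xm0 _ m p0'; have nm0 := xm0 _ m n0'.
have pim0 := xm0 _ m pi0; have two0 := xm0 _ m (ltr0Sn R 1).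
move: (_ ^+ s) (p%:R ^+ m) (n%:R ^+ m) (pi ^+ m) (2 ^+ m) ps0 pm0 nm0 pim0 two0.
by move=> a b c d e a0 b0 c0 d0 e0; field; rewrite a0 b0 c0 d0 e0.
Qed.

Theorem theoremA (R : realType) (p : nat) (p_prime : prime p) :
  (forall k q : nat, (1 <= k)%N -> q = (p ^ k)%N ->
    butson_proba R q 2 N
      / Num.sqrt ((p%:R ^ (2 - (q %/ p)%:Z) * q%:R ^+ (q - q %/ p))
                  / (2 * pi * N%:R) ^+ (q - q %/ p))
      @[N --> within [set N : nat | (p %| N)%N] \oo] --> (1 : R))
  /\
  (butson_proba R p 2 N
     / Num.sqrt (p%:R ^+ p / (2 * pi * N%:R) ^+ (p - 1))
     @[N --> within [set N : nat | (p %| N)%N] \oo] --> (1 : R)).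
Proof.
have p0 := prime_gt0 p_prime.
have prime_power k q : (1 <= k)%N -> q = (p ^ k)%N ->
    butson_proba R q 2 N
      / Num.sqrt ((p%:R ^ (2 - (q %/ p)%:Z) * q%:R ^+ (q - q %/ p))
                  / (2 * pi * N%:R) ^+ (q - q %/ p))
      @[N --> within [set N : nat | (p %| N)%N] \oo] --> (1 : R).
  case: k => // k _ ->; have s0 : (0 < p ^ k)%N by rewrite expn_gt0 p0.
  apply: cvg_within_dvdn => //.
  have -> : (p ^ k.+1 %/ p = p ^ k)%N by rewrite expnS mulKn.
  have -> : (p ^ k.+1 - p ^ k = p.-1 * p ^ k)%N.
    by rewrite expnS -[X in (_ - X)%N]mul1n -mulnBl subn1.
  set L : R := p%:R / p%:R ^+ (p ^ k) * local_density R p (p ^ k) ^+ (p ^ k).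
  have L0 : L != 0.
    by rewrite gt_eqF// !mulr_gt0 ?invr_gt0 ?exprn_gt0 ?local_density_gt0 ?ltr0n.
  have : Num.sqrt n%:R ^+ (p.-1 * p ^ k) * butson_proba R (p ^ k.+1) 2 (p * n) / L
      @[n --> \oo] --> L / L.
    by apply: cvgM (cvg_cst _); exact: butson_proba2_cvg.
  rewrite divff// => lim; apply: cvg_trans lim; apply: near_eq_cvg; near=> n.
  have n0 : (0 < n)%N by near: n; exact: nbhs_infty_gt.
  rewrite expnS butson_asymptoticE// -/L invf_div.
  by rewrite [RHS]mulrCA mulrA.
(* For [k = 1] the exponent [2 - q / p] is 1, and [p * p ^ (p - 1)] is [p ^ p]. *)
split=> //; have := prime_power 1%N p isT (esym (expn1 p)).
rewrite divnn p0 -[(2 - 1%:Z)]/1%:Z expr1z -exprS.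
by rewrite subn1 prednK.
Unshelve. all: by end_near. Qed.
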